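(* Let $H^{(1)}=\sum_{X\in S}\lambda_X^{(1)}h_X^{(1)}$ and $H^{(2)}=\sum_{X\in S}\lambda_X^{(2)}h_X^{(2)}$ be local Hamiltonians on a common set $S$ of subsystems whose interaction graph has maximum degree $\mathfrak{d}\ge1$, let $\rho$ be a product state, let $t_L^*=1/[2e^2\mathfrak{d}(\mathfrak{d}+1)]$, and let $t\in\mathbb{R}$ with $|t|\le t_L^*/7$. For $\delta>0$, the probability that a projective measurement of the state $e^{-itH^{(1)}}\rho\,e^{itH^{(1)}}$ onto the eigenbasis of $H^{(2)}$ yields a value $x$ that deviates from the expectation value $\mathrm{tr}[e^{-itH^{(1)}}\rho\,e^{itH^{(1)}}H^{(2)}]$ by at least $\delta$ is bounded from above by $$\mathrm{Pr}\left[\left|x-\mathrm{tr}\left(e^{-itH^{(1)}}\rho\,e^{itH^{(1)}}H^{(2)}\right)\right|\ge\delta\right]\le2\exp\left(-\frac{(\delta t_L^* )^2}{(250)^2|S|}\right).$$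
   Context: $V$ is a set of $n$ spins; each $v\in V$ carries a Hilbert space $\mathcal{H}^v$ of dimension $d$, and $\mathcal{H}=\bigotimes_{v\in V}\mathcal{H}^v$. A subsystem is a subset $X\subseteq V$. The support of a linear operator is the smallest subsystem on which it acts nontrivially. $S$ is a set of subsystems with $|X|\le k$ for all $X\in S$, for some fixed $k$. For $l=1,2$ and $X\in S$: $\lambda_X^{(l)}\in\mathbb{R}$, $|\lambda_X^{(l)}|\le1$, and $h_X^{(l)}$ is Hermitian with support $X$ and operator norm $1$. The interaction graph is the simple graph with vertex set $S$ in which two distinct $X,Y\in S$ are joined by an edge iff $X\cap Y\ne\emptyset$; $\mathfrak{d}$ is its maximum degree. A product state is $\rho=\bigotimes_{v\in V}\rho_v$ with each $\rho_v$ a density operator on $\mathcal{H}^v$. A projective measurement of an observable $B$ in a state $\sigma$ yields the eigenvalue $x$ of $B$ with probability $\mathrm{Pr}(x)=\mathrm{tr}[\Pi(x)\sigma]$, where $\Pi(x)$ is the projector onto the eigenspace of $B$ with eigenvalue $x$. *)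

(* Defs.v *)
From HB Require Import structures.
From mathcomp Require Import all_boot all_order all_algebra.
From mathcomp Require Import all_classical all_reals all_analysis.
From mathcomp Require Import complex.

Set Implicit Arguments.
Unset Strict Implicit.
Unset Printing Implicit Defensive.

Import Order.TTheory GRing.Theory Num.Theory.
Import numFieldNormedType.Exports.

Local Open Scope classical_set_scope.
Local Open Scope ring_scope.
Local Open Scope complex_scope.
Local Open Scope sesquilinear_scope.

(* Orthonormal bases are fixed once and for all: the Hilbert space of one spin
   is C^d and its tensor power over V has the product basis, indexed by the
   configurations s : V -> 'I_d, so that operators are matrices indexed by an
   enumeration of the configurations. *)
Notation config V d := {ffun V -> 'I_d}.
Notation operator R V d := 'M[R[i]]_#|{: config V d}|.

Section Operators.
Variables (R : realType) (d : nat).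

Definition entry (V : finType) (A : operator R V d) (s s' : config V d) : R[i] :=
  A (enum_rank s) (enum_rank s').

Definition of_entries (V : finType) (f : config V d -> config V d -> R[i]) :
    operator R V d :=
  \matrix_(i, j) f (enum_val i) (enum_val j).

Definition restrict_config (V : finType) (X : {set V}) (s : config V d) :
    config {v : V | v \in X} d :=
  [ffun v => s (val v)].

(* B (x) 1, the identity factor being on the complement of X *)
Definition extend (V : finType) (X : {set V})
    (B : operator R {v : V | v \in X} d) : operator R V d :=
  of_entries (fun s s' =>
    entry B (restrict_config X s) (restrict_config X s')
      *+ [forall (v | v \notin X), s v == s' v]).

Definition acts_within (V : finType) (A : operator R V d) (X : {set V}) : Prop :=
  exists B : operator R {v : V | v \in X} d, A = extend B.

Definition is_support (V : finType) (A : operator R V d) (X : {set V}) : Prop :=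
  acts_within A X /\ forall Y : {set V}, acts_within A Y -> X \subset Y.

(* The norm carried by matrices in MathComp-Analysis is the maximum of the
   entries; the Euclidean norm and the operator norm are therefore spelled out. *)
Definition vnorm (n : nat) (u : 'cV[R[i]]_n) : R :=
  Num.sqrt (\sum_i ComplexField.Normc.normc (u i 0) ^+ 2).

Definition opnorm (n : nat) (A : 'M[R[i]]_n) : R :=
  sup [set vnorm (A *m u) | u in [set u : 'cV[R[i]]_n | vnorm u <= 1]].

Definition density (n : nat) (A : 'M[R[i]]_n) : Prop :=
  [/\ A \is hermsymmx,
      forall u : 'cV[R[i]]_n, 0 <= (u ^t* *m A *m u) 0 0
    & \tr A = 1].

Definition product_op (V : finType) (rho_ : V -> 'M[R[i]]_d) : operator R V d :=
  of_entries (fun s s' => \prod_(v : V) rho_ v (s v) (s' v)).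

Definition product_state (V : finType) (rho : operator R V d) : Prop :=
  exists2 rho_ : V -> 'M[R[i]]_d,
    forall v, density (rho_ v) & rho = product_op rho_.

(* lam and h are only constrained, and only used, on S. *)
Definition local_terms (V : finType) (S : {set {set V}})
    (lam : {set V} -> R) (h : {set V} -> operator R V d) : Prop :=
  forall X : {set V}, X \in S ->
    [/\ `|lam X| <= 1, h X \is hermsymmx, is_support (h X) X & opnorm (h X) = 1].

Definition hamiltonian (V : finType) (S : {set {set V}})
    (lam : {set V} -> R) (h : {set V} -> operator R V d) : operator R V d :=
  \sum_(X in S) (lam X)%:C *: h X.

Definition expm (n : nat) (A : 'M[R[i]]_n) : 'M[R[i]]_n :=
  limn (series (fun k => (k`!%:R^-1 : R[i]) *: A ^+ k)).

Definition evolve (n : nat) (H : 'M[R[i]]_n) (t : R) (rho : 'M[R[i]]_n) :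
    'M[R[i]]_n :=
  expm (- ('i%C * t%:C) *: H) *m rho *m expm (('i%C * t%:C) *: H).

(* eigenspace and proj_ortho act on row vectors.  For Hermitian B and real x
   this is the usual projector acting on columns: see eigenproj_herm,
   eigenproj_idem and eigenprojP below. *)
Definition eigenproj (n : nat) (B : 'M[R[i]]_n) (x : R[i]) : 'M[R[i]]_n :=
  proj_ortho (eigenspace B x).

(* The sum has finite support, since B has finitely many eigenvalues. *)
Definition measure_pr (n : nat) (B sigma : 'M[R[i]]_n) (E : set R[i]) : R[i] :=
  (\sum_(x \in [set x | eigenvalue B x] `&` E) \tr (eigenproj B x *m sigma))%R.

Lemma adj_mulmx (m n p : nat) (A : 'M[R[i]]_(m, n)) (B : 'M[R[i]]_(n, p)) :
  (A *m B) ^t* = B ^t* *m A ^t*.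
Proof. by rewrite trmx_mul map_mxM. Qed.

Lemma eigenproj_herm (n : nat) (B : 'M[R[i]]_n) (x : R[i]) :
  (eigenproj B x) ^t* = eigenproj B x.
Proof.
rewrite /eigenproj; set U := eigenspace B x; set P := proj_ortho U.
have PE : P *m P ^t* = P ^t*.
  have := proj_ortho_compl_sub U 1%:M; rewrite mul1mx -/P.
  rewrite -(eqmx_ortho _ (proj_orthoE U)) => /orthomx1P.
  by rewrite mulmxBl mul1mx => /subr0_eq.
by clearbody P; have := congr1 (fun M => M ^t*) PE; rewrite /= adj_mulmx trmxCK PE.
Qed.

Lemma eigenproj_idem (n : nat) (B : 'M[R[i]]_n) (x : R[i]) :
  eigenproj B x *m eigenproj B x = eigenproj B x.
Proof. exact: proj_ortho_proj. Qed.

Lemma eigenprojP (n : nat) (B : 'M[R[i]]_n) (x : R) (u : 'cV[R[i]]_n) :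
  B \is hermsymmx -> eigenproj B x%:C *m u = u <-> B *m u = x%:C *: u.
Proof.
move=> /is_hermitianmxP; rewrite expr0 scale1r => hB.
have adjP : (eigenproj B x%:C *m u) ^t* = u ^t* *m eigenproj B x%:C.
  by rewrite adj_mulmx eigenproj_herm.
have adjB : (B *m u) ^t* = u ^t* *m B by rewrite adj_mulmx -hB.
have adjx : (x%:C *: u) ^t* = x%:C *: u ^t*.
  apply/matrixP=> i j; rewrite !mxE rmorphM; congr (_ * _).
  by apply/eqP; rewrite eq_complex /= oppr0 !eqxx.
have adj_inj : injective (fun M : 'cV[R[i]]_n => M ^t*).
  by move=> M N /(congr1 (fun K => K ^t*)); rewrite /= !trmxCK.
split=> [Pu|Bu]; apply: adj_inj.
  rewrite adjB adjx; apply/eigenspaceP.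
  by rewrite -Pu adjP proj_ortho_sub.
rewrite adjP; apply: proj_ortho_id; apply/eigenspaceP.
by rewrite -adjB Bu adjx.
Qed.

End Operators.

Section InteractionGraph.
Variable V : finType.

Definition interact (X Y : {set V}) : bool := (X != Y) && (X :&: Y != finset.set0).

Definition max_degree (S : {set {set V}}) : nat :=
  \max_(X in S) #|[set Y in S | interact X Y]|.

End InteractionGraph.

Definition tL (R : realType) (D : nat) : R :=
  (2 * expR 1 ^+ 2 * D%:R * (D%:R + 1))^-1.

(* Main.v *)
(** The even moments of the outcome around its mean are bounded directly, without
expanding the logarithm of the moment generating function.

In the Heisenberg picture H2 evolves into the sum over n of
(it)^n/n! ad_{H1}^n(H2).  Expanding the nested commutators writes every partial
sum as a sum of operators a_Z indexed by clusters Z, i.e. connected sets of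
subsystems, with a_Z supported on the union of Z.  A connected growth argument
bounds the total weight of the n-th order clusters through a given subsystem by
(n+1)! (2(D+1))^n, so that for small t the norms of the a_Z, even weighted by
exp |Z|, are summable uniformly in the order of truncation.

Subtract from each a_Z its expectation in the product state.  In the expansion
of the 2m-th power, a term in which some cluster is disjoint from all the others
has expectation zero.  In the remaining terms no position is isolated, hence
some set of at most m positions dominates the others; choosing for every other
position a dominating neighbour gives a bound of order (C (D+1) |S| m)^m for the
2m-th moment.  Markov's inequality with m of the order of delta^2/((D+1) |S|)
concludes. *)

Require Import Defs.
From HB Require Import structures.
From mathcomp Require Import all_boot all_order all_algebra.
From mathcomp Require Import all_classical all_reals all_analysis.
From mathcomp Require Import complex finmap.
From mathcomp Require Import ring lra zify.
Import Order.TTheory GRing.Theory Num.Theory.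
Import numFieldNormedType.Exports.
Local Open Scope classical_set_scope.
Local Open Scope ring_scope.
Local Open Scope complex_scope.
Local Open Scope sesquilinear_scope.

Set Implicit Arguments.
Unset Strict Implicit.
Unset Printing Implicit Defensive.

Local Notation normc := ComplexField.Normc.normc.

(** * Counting sequences of clusters without isolated members *)

(* The complement of a minimal dominating set is dominating as well. *)
Lemma small_dominating_set (T : finType) (e : rel T) :
    symmetric e -> (forall i, exists2 j, j != i & e j i) ->
  exists2 A : {set T}, (#|A|.*2 <= #|T|)%N
    & forall j, j \notin A -> exists2 a, a \in A & e a j.
Proof.
move=> sym_e cov.
pose P (A : {set T}) := [forall (j | j \notin A), exists a in A, e a j].
have domP A : P A -> forall j, j \notin A -> exists2 a, a \in A & e a j.
  by move=> /forall_inP PA j /PA /exists_inP.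
have [A /minsetP[PA minA]] : {A | minset P A}.
  by apply: ex_minset; exists [set: T]%SET; apply/forall_inP => j; rewrite inE.
(* If some [j] in [A] had no neighbour outside [A], then [A :\ j] would still dominate: the
   neighbour [k] of [j] lies in [A], and no vertex outside [A] relies on [j]. This contradicts
   minimality. *)
have PcA : P (~: A).
  apply/forall_inP => j; rewrite inE negbK => jA.
  apply: contraT => nj; have [k kj ekj] := cov j.
  have inA i : e i j -> i \in A.
    by move=> eij; apply: contraNT nj => iA; apply/exists_inP; exists i; rewrite ?inE.
  have PAj : P (A :\ j).
    apply/forall_inP => i; rewrite !inE negb_and negbK => iA.
    apply/exists_inP; have [-> | ij] := eqVneq i j.
      by exists k; rewrite // !inE kj inA.
    have iNA : i \notin A by case/orP: iA => //; rewrite (negPf ij).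
    have [a aA eai] := domP A PA i iNA; exists a => //; rewrite !inE aA andbT.
    by apply: contra iNA => /eqP aj; apply: inA; rewrite sym_e -aj.
  have /setP/(_ j) := minA _ PAj (subD1set A j).
  by rewrite !inE eqxx jA.
have cardA := cardsC A.
have [lA | lA] := leqP #|A| #|~: A|.
  by exists A; [rewrite -cardA -addnn leq_add2l | exact: domP].
by exists (~: A); [rewrite -cardA -addnn leq_add2r ltnW | exact: domP].
Qed.

Lemma exprn_le_fact_expR (R : realType) (x : R) n :
  0 <= x -> x ^+ n <= n`!%:R * expR x.
Proof.
move=> x0; case: n => [|n].
  by rewrite expr0 fact0 mul1r (le_trans _ (expR_ge1Dx x)) ?lerDl.
rewrite mulrC -ler_pdivrMr ?ltr0n ?fact_gt0//.
by rewrite (le_trans _ (expR_ge1Dxn n x0))// lerDr.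
Qed.

Section Counting.
Variables (R : realType) (I : finType) (w : I -> R) (s : I -> nat).
Variables (touch : rel I) (k1 k2 : R).
Hypothesis w_ge0 : forall i, 0 <= w i.
Hypothesis sum_w : \sum_i w i * expR (s i)%:R <= k1.
Hypothesis sum_touch : forall j, \sum_(i | touch j i) w i <= (s j)%:R * k2.
Hypothesis k2_ge0 : 0 <= k2.
Hypothesis touch_sym : symmetric touch.

(** A word [g] picks one summand for each factor of an [n]-th power. Covered words have no isolated
    position; they are the ones whose expectation may differ from zero. *)
Definition covered n (g : {ffun 'I_n -> I}) :=
  [forall i, exists j, (j != i) && touch (g j) (g i)].

Lemma sum_bound_ge0 : 0 <= k1.
Proof. by apply: le_trans sum_w; apply: sumr_ge0 => i _; rewrite mulr_ge0 ?expR_ge0. Qed.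

(** The crude bound that forgets the covering condition; it serves when [k1] is smaller than
    [k2 * n]. *)
Lemma sum_ffun_prod n : \sum_(g : {ffun 'I_n -> I}) \prod_i w (g i) <= k1 ^+ n.
Proof.
rewrite -(bigA_distr_bigA (fun _ => w)) prodr_const card_ord.
apply: lerXn2r; rewrite ?nnegrE ?sum_bound_ge0 ?sumr_ge0//.
apply: le_trans sum_w; apply: ler_sum => i _.
by rewrite ler_peMr// -expR0 ler_expR.
Qed.

(* Summing over the choice, for every position outside A, of a neighbour in A
   gives (k2 * \sum_(i in A) s_i) ^ (n - |A|), and x ^ N <= N! e ^ x is absorbed
   by the exponential weight of the members in A. *)
Lemma sum_dominated n (A : {set 'I_n}) (i0 : I) :
  \sum_(g : {ffun 'I_n -> I}
        | [forall (j | j \notin A), exists a in A, touch (g a) (g j)])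
    \prod_i w (g i)
  <= k1 ^+ #|A| * (k2 ^+ (n - #|A|) * (n - #|A|)`!%:R).
Proof.
(* [r g] remembers [g] on [A] only, with the default [i0] elsewhere; each fibre of [r] fixes the
   members on the dominating set. *)
pose r (g : {ffun 'I_n -> I}) := [ffun i => if i \in A then g i else i0].
pose N := (n - #|A|)%N.
have cardN : #|~: A| = N by rewrite cardsCs finset.setCK card_ord.
rewrite (partition_big r (mem (pffun_on i0 (mem A) predT))) /=; last first.
  move=> g _; apply/pffun_onP; split=> //.
  by apply/supportP => x; rewrite ffunE => /negPf ->.
have step u : \sum_(g : {ffun 'I_n -> I}
        | [forall (j | j \notin A), exists a in A, touch (g a) (g j)] && (r g == u))
    \prod_i w (g i) <=
   (\prod_(i in A) (w (u i) * expR (s (u i))%:R)) * (k2 ^+ N * N`!%:R).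
  (* Domination is relaxed to a product over positions: agreement with [u] on [A], and a union bound
     over the dominating neighbour off [A]. The sum over [g] then factorises. *)
  pose F i x := if i \in A then (x == u i)%:R * w x
                else \sum_(a in A) (touch (u a) x)%:R * w x.
  have F_ge0 i x : 0 <= F i x.
    rewrite /F; case: ifP => _; first by rewrite mulr_ge0 ?ler0n.
    by apply: sumr_ge0 => a _; rewrite mulr_ge0 ?ler0n.
  apply: (@le_trans _ _ (\sum_(g : {ffun 'I_n -> I}) \prod_i F i (g i))).
    rewrite big_mkcond; apply: ler_sum => g _; case: ifP => [|_]; last exact: prodr_ge0.
    case/andP => /forall_inP dom /eqP ru; apply: ler_prod => i _.
    rewrite w_ge0 /= /F; have uE a : a \in A -> u a = g a.
      by move=> aA; rewrite -ru ffunE aA.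
    case: ifPn => iA; first by rewrite uE// eqxx mul1r.
    have /exists_inP[a aA tai] := dom i iA.
    rewrite (bigD1 a)//= uE// tai mul1r lerDl sumr_ge0// => b _.
    by rewrite mulr_ge0 ?ler0n.
  rewrite -(bigA_distr_bigA F) (bigID (mem A)) /=.
  have -> : \prod_(i in A) \sum_j F i j = \prod_(i in A) w (u i).
    apply: eq_bigr => i iA; rewrite (bigD1 (u i))//= big1 => [|j jn].
      by rewrite /F iA eqxx mul1r addr0.
    by rewrite /F iA (negPf jn) mul0r.
  rewrite big_split /= -mulrA ler_wpM2l ?prodr_ge0//.
  have -> : \prod_(i in A) expR (s (u i))%:R = expR (\sum_(i in A) (s (u i))%:R) :> R.
    by rewrite expR_sum.
  set x := \sum_(i in A) _.
  have x0 : 0 <= x by apply: sumr_ge0.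
  apply: (@le_trans _ _ ((x * k2) ^+ N)); last first.
    rewrite exprMn mulrC mulrCA ler_wpM2l ?exprn_ge0// mulrC.
    exact: exprn_le_fact_expR.
  rewrite -cardN -prodr_const big_mkcond [leRHS]big_mkcond /=.
  apply: ler_prod => i _; rewrite inE; case: ifPn => iA; last by rewrite ler01 lexx.
  rewrite sumr_ge0//=; under eq_bigr do rewrite /F (negPf iA).
  rewrite exchange_big mulr_suml; apply: ler_sum => a _.
  rewrite (le_trans _ (sum_touch _))// [leRHS]big_mkcond; apply: ler_sum => j _.
  by case: (touch _ _); rewrite ?mul1r ?mul0r.
apply: le_trans; first by apply: ler_sum => u _; exact: step.
rewrite -mulr_suml ler_wpM2r ?mulr_ge0 ?exprn_ge0 ?ler0n//.
rewrite -(big_distr_big i0 (mem A) predT (fun _ x => w x * expR (s x)%:R)) prodr_const.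
apply: lerXn2r; rewrite ?nnegrE ?sum_bound_ge0 ?sumr_ge0// => i _.
by rewrite mulr_ge0 ?expR_ge0.
Qed.

(** Every covered word of length [2m] is dominated by at most [m] of its positions. The bound of
    [sum_dominated] is summed over these sets, of which there are at most [4 ^ m]; each contributes
    at most [(k1 * k2 * 2m) ^ m]. *)
Lemma sum_covered_prod (i0 : I) m :
  \sum_(g : {ffun 'I_m.*2 -> I} | covered g) \prod_i w (g i)
  <= (4 * (k1 * k2 * m.*2%:R)) ^+ m.
Proof.
set n := m.*2; have nE : n = (2 * m)%N by rewrite mul2n.
have prodw_ge0 (g : {ffun 'I_n -> I}) : 0 <= \prod_i w (g i) by apply: prodr_ge0.
(* If [k1 < k2 * n], then [k1 ^ n = (k1 * k1) ^ m] is already below the claimed bound. *)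
have [kle | klt] := leP (k2 * n%:R) k1; last first.
  apply: le_trans (_ : k1 ^+ n <= _).
    apply: le_trans (sum_ffun_prod n).
    by rewrite [leLHS]big_mkcond ler_sum// => g _; case: ifP.
  rewrite nE exprM; apply: lerXn2r.
  - by rewrite nnegrE exprn_ge0 ?sum_bound_ge0.
  - by rewrite nnegrE !mulr_ge0 ?sum_bound_ge0.
  have k1_0 := sum_bound_ge0; rewrite expr2 -nE -(mulrA k1) mulrCA ler_wpM2l//.
  by rewrite (le_trans (ltW klt))// ler_peMl ?mulr_ge0// ler1n.
apply: (@le_trans _ _ (\sum_(A : {set 'I_n} | (#|A| <= m)%N)
     k1 ^+ #|A| * (k2 ^+ (n - #|A|) * (n - #|A|)`!%:R))).
  pose D (A : {set 'I_n}) (g : {ffun 'I_n -> I}) :=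
    [forall (j | j \notin A), exists a in A, touch (g a) (g j)].
  apply: (@le_trans _ _ (\sum_(A : {set 'I_n} | (#|A| <= m)%N)
     \sum_(g : {ffun 'I_n -> I} | D A g) \prod_i w (g i))); last first.
    by apply: ler_sum => A _; exact: sum_dominated.
  rewrite (exchange_big_dep predT)//= [leLHS]big_mkcond; apply: ler_sum => g _.
  case: ifP => [/forallP cov|_]; last exact: sumr_ge0.
  pose e : rel 'I_n := fun i j => touch (g i) (g j).
  have [||A cA dA] := @small_dominating_set _ e.
  - by move=> i j; rewrite /e touch_sym.
  - by move=> i; have /existsP[j /andP[ji eji]] := cov i; exists j.
  rewrite (bigD1 A) /=; first by rewrite lerDl sumr_ge0.
  move: cA; rewrite card_ord leq_double => -> /=.
  by apply/forall_inP => j /dA[a aA eaj]; apply/exists_inP; exists a.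
have -> : (4 * (k1 * k2 * n%:R)) ^+ m = \sum_(A : {set 'I_n}) (k1 * (k2 * n%:R)) ^+ m.
  rewrite sumr_const exprMn mulrA -[4]/(4%:R) -natrX mulr_natl; congr (_ *+ _).
  by rewrite -cardsT -powersetT card_powerset cardsT card_ord nE expnM.
rewrite big_mkcond; apply: ler_sum => A _; case: ifP => [lA|_]; last first.
  by rewrite exprn_ge0// !mulr_ge0 ?sum_bound_ge0.
have nA : (n - #|A| = (m - #|A|) + m)%N by move: (lA); lia.
have -> : (k1 * (k2 * n%:R)) ^+ m
    = k1 ^+ #|A| * (k1 ^+ (m - #|A|) * (k2 * n%:R) ^+ m).
  by rewrite exprMn mulrA -exprD subnKC.
rewrite ler_wpM2l ?exprn_ge0 ?sum_bound_ge0//.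
(* [N! <= n ^ N] for [N = n - #|A|]; of the resulting factors [k2 * n], the [m - #|A|] in excess of
   [m] are then traded for [k1]. *)
apply: (@le_trans _ _ ((k2 * n%:R) ^+ (n - #|A|))).
  rewrite exprMn ler_wpM2l ?exprn_ge0// -natrX ler_nat fact_prod.
  rewrite -[X in (_ <= _ ^ X)%N](subn0 (n - #|A|)%N) -[X in (_ <= _ ^ X)%N]subSS.
  rewrite -prod_nat_const_nat big_nat [leqRHS]big_nat; apply: leq_prod => i /andP[_].
  by rewrite ltnS => /leq_trans; apply; rewrite leq_subr.
rewrite nA exprD ler_wpM2r ?exprn_ge0 ?mulr_ge0//.
by apply: lerXn2r; rewrite ?nnegrE ?sum_bound_ge0 ?mulr_ge0.
Qed.

End Counting.

(** * Local operators and product states *)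

Section Locality.
Variables (R : realType) (d : nat) (V : finType).
Implicit Types (A B C : operator R V d) (X Y : {set V}) (s r u : config V d).

Lemma entryM A B s s' :
  entry (A *m B) s s' = \sum_r entry A s r * entry B r s'.
Proof.
rewrite /entry mxE (reindex enum_rank) //=.
by apply: onW_bij; exact: enum_rank_bij.
Qed.

Lemma mxtrace_entry A : \tr A = \sum_s entry A s s.
Proof.
by rewrite /mxtrace (reindex enum_rank) //; apply: onW_bij; exact: enum_rank_bij.
Qed.

Lemma entry_inj A B : (forall s s', entry A s s' = entry B s s') -> A = B.
Proof.
move=> AB; apply/matrixP => i j.
by have := AB (enum_val i) (enum_val j); rewrite /entry !enum_valK.
Qed.

Lemma entry_of_entries (f : config V d -> config V d -> R[i]) s s' :
  entry (of_entries f) s s' = f s s'.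
Proof. by rewrite /entry mxE !enum_rankK. Qed.

Lemma entry1 s s' : entry (1%:M : operator R V d) s s' = (s == s')%:R.
Proof. by rewrite /entry mxE (inj_eq enum_rank_inj). Qed.

Definition glue X s s' : config V d := [ffun v => if v \in X then s v else s' v].

(* [acts_within A X] in terms of the entries of A: they vanish unless the two
   configurations agree off X, and do not depend on the values off X. *)
Definition local X A :=
  (forall s s', glue X s s' != s -> entry A s s' = 0) /\
  (forall s s' u u', entry A (glue X s u) (glue X s' u)
                   = entry A (glue X s u') (glue X s' u')).

Lemma glue_glue_l X s r u : glue X (glue X s r) u = glue X s u.
Proof. by apply/ffunP => v; rewrite !ffunE; case: (v \in X). Qed.

Lemma glue_glue_r X s r u : glue X s (glue X r u) = glue X s u.
Proof. by apply/ffunP => v; rewrite !ffunE; case: (v \in X). Qed.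

Lemma glue_id X s : glue X s s = s.
Proof. by apply/ffunP => v; rewrite !ffunE; case: (v \in X). Qed.

Lemma glueC X s r : glue (~: X) s r = glue X r s.
Proof. by apply/ffunP => v; rewrite !ffunE inE if_neg. Qed.

Lemma glue_eqP X s s' :
  reflect (forall v, v \notin X -> s' v = s v) (glue X s s' == s).
Proof.
apply: (iffP eqP) => [/ffunP E v vX | E].
  by have := E v; rewrite ffunE (negPf vX).
by apply/ffunP => v; rewrite ffunE; case: ifPn => // /E.
Qed.

Lemma acts_within_local A X : acts_within A X -> local X A.
Proof.
case=> B ->; split=> [s s' ss'|s s' u u'].
  rewrite entry_of_entries; case: forall_inP => [E|]; last by rewrite mulr0n.
  by case/glue_eqP: ss' => v /E/eqP.
rewrite !entry_of_entries.
have R1 (r t : config V d) : restrict_config X (glue X r t) = restrict_config X r.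
  by apply/ffunP => v; rewrite !ffunE (valP v).
rewrite !R1; congr (_ *+ _).
have E t : [forall (v | v \notin X), glue X s t v == glue X s' t v] = true.
  by apply/forall_inP => v vX; rewrite !ffunE (negPf vX).
by rewrite !E.
Qed.

Lemma local1 X : local X (1%:M).
Proof.
split=> [s s'|s s' u u']; rewrite !entry1.
  by apply: contraNeq; rewrite pnatr_eq0 eqb0 negbK => /eqP <-; rewrite glue_id.
congr (_%:R).
suff E t : (glue X s t == glue X s' t) = [forall (v | v \in X), s v == s' v].
  by rewrite !E.
apply/eqP/forall_inP => [/ffunP E v vX|E].
  by have := E v; rewrite !ffunE vX => ->.
by apply/ffunP => v; rewrite !ffunE; case: ifP => // /E/eqP.
Qed.

Lemma local0 X : local X 0.
Proof. by split=> *; rewrite /entry !mxE. Qed.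

Lemma localD X A B : local X A -> local X B -> local X (A + B).
Proof.
rewrite /local /entry => -[A1 A2] [B1 B2]; split=> [s s' ss'|s s' u u']; rewrite !mxE.
  by rewrite A1 ?B1 ?addr0.
by rewrite (A2 s s' u u') (B2 s s' u u').
Qed.

Lemma localZ X c A : local X A -> local X (c *: A).
Proof.
rewrite /local /entry => -[A1 A2]; split=> [s s' ss'|s s' u u']; rewrite !mxE.
  by rewrite A1 ?mulr0.
by rewrite (A2 s s' u u').
Qed.

Lemma localN X A : local X A -> local X (- A).
Proof. by rewrite -scaleN1r; exact: localZ. Qed.

Lemma local_sum X (I : Type) (l : seq I) (P : pred I) (F : I -> operator R V d) :
  (forall i, P i -> local X (F i)) -> local X (\sum_(i <- l | P i) F i).
Proof. by move=> FX; elim/big_ind: _ => //; [exact: local0 | exact: localD]. Qed.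

Lemma localM X A B : local X A -> local X B -> local X (A *m B).
Proof.
move=> [A1 A2] [B1 B2]; split=> [s s' ss'|s s' u u']; rewrite !entryM.
  apply: big1 => r _; have [sr|sr] := boolP (glue X s r == s); last by rewrite A1 ?mul0r.
  have [rs|rs] := boolP (glue X r s' == r); last by rewrite B1 ?mulr0.
  case/negP: ss'; apply/glue_eqP => v vX.
  by rewrite (glue_eqP _ _ _ rs)// (glue_eqP _ _ _ sr).
have E t : \sum_r entry A (glue X s t) r * entry B r (glue X s' t) =
    \sum_(r | glue X r t == r) entry A (glue X s t) r * entry B r (glue X s' t).
  rewrite [RHS]big_mkcond; apply: eq_bigr => r _; case: ifPn => // rt.
  rewrite A1 ?mul0r//; apply: contra rt => /glue_eqP rt.
  by apply/glue_eqP => v vX; rewrite rt// ffunE (negPf vX).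
(* The surviving intermediate configurations carry [u] off [X]; replacing [u] by [u'] there matches
   the two sums term by term. *)
rewrite !E (reindex_onto (fun r => glue X r u) (fun r => glue X r u')) /=; last first.
  by move=> r /eqP <-; rewrite !glue_glue_l.
apply: eq_big => r; first by rewrite !glue_glue_l eqxx.
by rewrite !glue_glue_l => /andP[_ /eqP ru]; rewrite (A2 _ _ u u') (B2 _ _ u u') ru.
Qed.

Lemma local_sub X Y A : X \subset Y -> local X A -> local Y A.
Proof.
move=> /fintype.subsetP XY [A1 A2]; split=> [s s' ss'|s s' u u'].
  apply: A1; apply: contra ss' => /glue_eqP E; apply/glue_eqP => v vY.
  by apply: E; apply: contra vY; exact: XY.
(* If [s] and [s'] agree on [Y] minus [X], these sites join the environment and locality in [X]
   applies; otherwise both entries vanish. *)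
have [E|E] := boolP [forall (v | v \in Y :\: X), s v == s' v].
  have M t (r : config V d) : [forall (v | v \in Y :\: X), s v == r v] ->
      glue Y r t = glue X r (glue Y s t).
    move=> /forall_inP rs; apply/ffunP => v; rewrite !ffunE.
    case: (boolP (v \in X)) => vX; first by rewrite XY.
    by case: ifP => // vY; apply/esym/eqP/rs; rewrite inE vX.
  have ss : [forall (v | v \in Y :\: X), s v == s v] by apply/forall_inP.
  have N t : entry A (glue Y s t) (glue Y s' t) =
      entry A (glue X s (glue Y s t)) (glue X s' (glue Y s t)).
    by rewrite -(M t s ss) -(M t s' E).
  by rewrite N [RHS]N; exact: A2.
have Z t : entry A (glue Y s t) (glue Y s' t) = 0.
  apply: A1; apply: contra E => /glue_eqP E; apply/forall_inP => v.
  by rewrite inE => /andP[vX vY]; have := E v vX; rewrite !ffunE vY => ->.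
by rewrite !Z.
Qed.

Lemma local_entry X A s s' u : local X A -> glue X s s' = s ->
  entry A s s' = entry A (glue X s u) (glue X s' u).
Proof.
move=> [_ A2] E; rewrite -(A2 s s' s').
by rewrite E glue_id.
Qed.

(** A single intermediate configuration survives: [A] changes values on [X] only and [B] off [X]
    only, so it must agree with [s'] on [X] and with [s] elsewhere. *)
Lemma entry_mul_local X A B s s' : local X A -> local (~: X) B ->
  entry (A *m B) s s' = entry A s (glue X s' s) * entry B (glue X s' s) s'.
Proof.
move=> [A1 A2] [B1 B2]; rewrite entryM (bigD1 (glue X s' s))//= big1 ?addr0// => r.
apply: contraNeq; rewrite mulf_eq0 negb_or => /andP[Ar Br].
have /glue_eqP rs : glue X s r == s by apply: contraNT Ar => /A1 ->.
have /glue_eqP sr : glue (~: X) r s' == r by apply: contraNT Br => /B1 ->.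
apply/eqP/ffunP => v; rewrite ffunE; case: ifPn => vX; last exact: rs.
by rewrite sr // inE vX.
Qed.

Lemma local_comm X A B : local X A -> local (~: X) B -> A *m B = B *m A.
Proof.
move=> AX BX; apply: entry_inj => s s'.
have AXC : local (~: ~: X) A by rewrite finset.setCK.
rewrite (entry_mul_local _ _ AX BX) (entry_mul_local _ _ BX AXC) mulrC !glueC.
congr (_ * _).
  rewrite (@local_entry (~: X) B _ _ s)// !glueC; last by rewrite glue_glue_r.
  by rewrite glue_glue_r glue_id.
rewrite (@local_entry X A _ _ s')//; last by rewrite glue_glue_r glue_id.
by rewrite !glue_glue_l glue_id.
Qed.

Variable rho_ : V -> 'M[R[i]]_d.
Local Notation rho := (product_op rho_).

(** Entries of a product operator factor over the sites, and exchanging two copies off [X] merely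
    permutes the factors. *)
Lemma product_op_swap X s r s' r' :
  entry rho (glue X s s') (glue X r r') * entry rho (glue X s' s) (glue X r' r)
  = entry rho s r * entry rho s' r'.
Proof.
rewrite !entry_of_entries -!big_split; apply: eq_bigr => v _.
rewrite !ffunE; case: (v \in X) => //.
exact: mulrC.
Qed.

Lemma mxtrace_mul_entry A B : \tr (A *m B) = \sum_s \sum_r entry A s r * entry B r s.
Proof. by rewrite mxtrace_entry; under eq_bigr do rewrite entryM. Qed.

(* In two copies of the system, swap the values of the copies off X. *)
Lemma tr_product_op_mul X A B : local X A -> local (~: X) B ->
  \tr (rho *m (A *m B)) * \tr rho = \tr (rho *m A) * \tr (rho *m B).
Proof.
move=> AX BX; have [A1 A2] := AX; have [B1 B2] := BX.
have tr1 : \tr rho = \sum_s \sum_r entry rho s r * entry 1%:M r s.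
  by rewrite -mxtrace_mul_entry mulmx1.
rewrite tr1 !mxtrace_mul_entry.
pose h (p : config V d * config V d) := (glue X p.1 p.2, glue X p.2 p.1).
have hK : involutive h.
  by case=> s s'; rewrite /h /= !glue_glue_l !glue_glue_r !glue_id.
have sum2 (F G : config V d -> config V d -> R[i]) :
    (\sum_s \sum_r F s r) * (\sum_s \sum_r G s r) =
    \sum_p \sum_q F p.1 q.1 * G p.2 q.2.
  rewrite big_distrlr pair_bigA; apply: eq_bigr => p _.
  by rewrite big_distrlr pair_bigA.
rewrite !sum2 [RHS](reindex_inj (inv_inj hK)) /=.
apply: eq_bigr => -[s s'] _ /=; rewrite [RHS](reindex_inj (inv_inj hK)) /=.
apply: eq_bigr => -[r r'] _ /=; rewrite mulrACA [RHS]mulrACA product_op_swap; congr (_ * _).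
rewrite entry1 (entry_mul_local _ _ AX BX).
case: eqVneq => [->|rs]; rewrite ?mulr1 ?mulr0.
  congr (_ * _); last first.
    by rewrite (@local_entry (~: X) B _ _ s')// ?glueC ?glue_glue_r ?glue_id//
      !glue_glue_l.
  by rewrite (@local_entry X A _ _ s')// ?glue_glue_r ?glue_glue_l ?glue_id.
(* [r'] and [s'] differ on [X] or off it; after the swap the entry of [B] vanishes in the first case
   and that of [A] in the second. *)
have [E|E] := boolP (glue X (glue X r r') (glue X s s') == glue X r r'); last first.
  by rewrite A1 ?mul0r.
rewrite [entry B _ _]B1 ?mulr0//; apply: contra rs => /glue_eqP F; apply/eqP/ffunP => v.
have [vX|vX] := boolP (v \in X).
  by have := F v; rewrite inE vX !ffunE vX => ->.
by have := glue_eqP _ _ _ E v vX; rewrite !ffunE (negPf vX).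
Qed.

End Locality.

(** * Operator norm bounds and states *)

Section Norms.
Variable R : realType.
Implicit Types (z : R[i]).

Lemma normr_normc z : `|z| = (normc z)%:C.
Proof. by []. Qed.

Lemma normc_ge0 z : 0 <= normc z.
Proof. by rewrite -ler0c -normr_normc. Qed.

Lemma ler_normcD z z' : normc (z + z') <= normc z + normc z'.
Proof. by rewrite -lecR rmorphD /= -!normr_normc ler_normD. Qed.

Lemma normcN z : normc (- z) = normc z.
Proof. by apply/complexI; rewrite -!normr_normc normrN. Qed.

Lemma normc_real (x : R) : normc x%:C = `|x|.
Proof. by rewrite /= expr0n addr0 sqrtr_sqr. Qed.

Lemma adjmxZ m n c (A : 'M[R[i]]_(m, n)) : (c *: A) ^t* = c^*%C *: A ^t*.
Proof. by apply/matrixP => i j; rewrite !mxE rmorphM. Qed.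

Lemma adjmx_sum m n (I : Type) (r : seq I) (P : pred I) (F : I -> 'M[R[i]]_(m, n)) :
  (\sum_(i <- r | P i) F i) ^t* = \sum_(i <- r | P i) (F i) ^t*.
Proof.
apply: (big_morph (fun M : 'M[R[i]]_(m, n) => M ^t*)) => [A B|].
  by apply/matrixP => i j; rewrite !mxE rmorphD.
by apply/matrixP => i j; rewrite !mxE rmorph0.
Qed.

Lemma hermsymmxE n (A : 'M[R[i]]_n) : (A \is hermsymmx) = (A == A ^t*).
Proof. by rewrite is_hermitianmxE expr0 scale1r. Qed.

Variable n : nat.
Implicit Types (u v : 'cV[R[i]]_n) (A B : 'M[R[i]]_n).

Lemma vnorm_ge0 u : 0 <= vnorm u.
Proof. exact: sqrtr_ge0. Qed.

Lemma sqr_vnorm u : ((vnorm u) ^+ 2)%:C = (u ^t* *m u) 0 0.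
Proof.
rewrite sqr_sqrtr; last by apply: sumr_ge0 => i _; rewrite sqr_ge0.
rewrite rmorph_sum mxE; apply: eq_bigr => i _.
by rewrite !mxE rmorphXn /= -normr_normc mulrC -normCK.
Qed.

Lemma vnorm_dotmx u : ((vnorm u) ^+ 2)%:C = dotmx (u ^t*) (u ^t*).
Proof. by rewrite dotmxE trmxCK sqr_vnorm. Qed.

Lemma vnormZ c u : vnorm (c *: u) = normc c * vnorm u.
Proof.
apply/eqP; rewrite -(@eqrXn2 _ 2)// ?mulr_ge0 ?vnorm_ge0 ?normc_ge0//.
apply/eqP/complexI; rewrite exprMn [in RHS]rmorphM /= !sqr_vnorm.
rewrite adjmxZ -scalemxAl -scalemxAr scalerA mxE; congr (_ * _).
by rewrite rmorphXn /= -normr_normc normCK mulrC.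
Qed.

Lemma cauchy_schwarz u v : normc ((u ^t* *m v) 0 0) <= vnorm u * vnorm v.
Proof.
rewrite -ler_sqr ?nnegrE ?mulr_ge0 ?vnorm_ge0 -?ler0c -?normr_normc//.
rewrite -lecR exprMn [X in _ <= X]rmorphM /= !vnorm_dotmx rmorphXn /= -normr_normc.
rewrite -{1}(trmxCK v) -dotmxE.
exact: (CauchySchwarz (@dotmx R[i] n) (u ^t*) (v ^t*)).1.
Qed.

Lemma vnormD u v : vnorm (u + v) <= vnorm u + vnorm v.
Proof.
rewrite -lecR rmorphD /=.
have E (w : 'cV[R[i]]_n) : (vnorm w)%:C = sqrtC (dotmx (w ^t*) (w ^t*)).
  by rewrite -vnorm_dotmx rmorphXn /= sqrCK// ler0c vnorm_ge0.
rewrite !E.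
have -> : (u + v) ^t* = u ^t* + v ^t* by rewrite linearD /= map_mxD.
exact: (triangle_lerif (@dotmx R[i] n) (u ^t*) (v ^t*)).1.
Qed.

(** Upper bounds for the operator norm compose under sums and products without any discussion of the
    supremum in [opnorm]. *)
Definition opbound (c : R) A := forall u, vnorm (A *m u) <= c * vnorm u.

Lemma opboundD a b A B : opbound a A -> opbound b B -> opbound (a + b) (A + B).
Proof.
move=> hA hB u; rewrite mulmxDl mulrDl (le_trans (vnormD _ _))//.
exact: lerD.
Qed.

Lemma opboundM a b A B : 0 <= a -> opbound a A -> opbound b B -> opbound (a * b) (A *m B).
Proof.
move=> a0 hA hB u; rewrite -mulmxA -mulrA (le_trans (hA _))//.
exact: ler_wpM2l.
Qed.

Lemma opboundZ a c A : opbound a A -> opbound (normc c * a) (c *: A).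
Proof.
move=> hA u; rewrite -scalemxAl vnormZ -mulrA ler_wpM2l//.
by rewrite -ler0c -normr_normc.
Qed.

Lemma opboundN a A : opbound a A -> opbound a (- A).
Proof.
move=> hA u; rewrite -scaleN1r -scalemxAl vnormZ normcN.
by rewrite ComplexField.Normc.normc1 mul1r.
Qed.

Lemma opbound1 : opbound 1 1%:M.
Proof. by move=> u; rewrite mul1mx mul1r. Qed.

Lemma vnorm0 : vnorm (0 : 'cV[R[i]]_n) = 0.
Proof. by rewrite -(scale0r 0) vnormZ ComplexField.Normc.normc0 mul0r. Qed.

Lemma opbound0 : opbound 0 0.
Proof. by move=> u; rewrite mul0mx mul0r vnorm0. Qed.

Lemma opbound_le a b A : a <= b -> opbound a A -> opbound b A.
Proof. by move=> ab hA u; rewrite (le_trans (hA u))// ler_wpM2r ?vnorm_ge0. Qed.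

Lemma opbound_sum (I : Type) (r : seq I) (P : pred I) (c : I -> R) (F : I -> 'M[R[i]]_n) :
  (forall i, P i -> opbound (c i) (F i)) ->
  opbound (\sum_(i <- r | P i) c i) (\sum_(i <- r | P i) F i).
Proof.
by move=> H; elim/big_ind2: _ => //; [exact: opbound0 | move=> *; exact: opboundD].
Qed.

Lemma opbound_prod (I : Type) (r : seq I) (P : pred I) (c : I -> R) (F : I -> 'M[R[i]]_n) :
  (forall i, 0 <= c i) -> (forall i, P i -> opbound (c i) (F i)) ->
  opbound (\prod_(i <- r | P i) c i) (\prod_(i <- r | P i) F i).
Proof.
move=> c0 H; suff [] : opbound (\prod_(i <- r | P i) c i) (\prod_(i <- r | P i) F i)
    /\ 0 <= \prod_(i <- r | P i) c i by [].
elim/big_ind2: _ => //; first by split=> //; exact: opbound1.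
  by move=> a A b B [hA a0] [hB b0]; split; [exact: opboundM | exact: mulr_ge0].
by move=> i Pi; split; [exact: H | exact: c0].
Qed.

Lemma vnorm_eq0 u : vnorm u = 0 -> u = 0.
Proof.
move=> u0; have := vnorm_dotmx u; rewrite u0 expr0n /= => /esym/eqP.
rewrite dnorm_eq0 => /eqP E; rewrite -(trmxCK u) E.
by rewrite linear0 map_mx0.
Qed.

Lemma opnorm1_opbound A : opnorm A = 1 -> opbound 1 A.
Proof.
rewrite /opnorm => A1 u; rewrite mul1r.
have [u0|u0] := eqVneq (vnorm u) 0.
  by rewrite (vnorm_eq0 u0) mulmx0 vnorm0.
set E := [set _ | _ in _] in A1.
(* [sup] takes the default value 0 on a set without a supremum, so the value 1 certifies that there
   is one. *)
have hE : has_sup E.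
  by apply: contrapT => nE; have := A1; rewrite sup_out// => /eqP; rewrite eq_sym oner_eq0.
have up : 0 < vnorm u by rewrite lt_neqAle eq_sym u0 vnorm_ge0.
pose v := ((vnorm u)^-1)%:C *: u.
have nv : normc ((vnorm u)^-1)%:C = (vnorm u)^-1.
  by apply/complexI; rewrite -normr_normc ger0_norm// ler0c invr_ge0 ltW.
have : vnorm (A *m v) <= 1.
  rewrite -A1; apply: sup_upper_bound => //; exists v => //=.
  by rewrite vnormZ nv mulVf.
by rewrite -scalemxAr vnormZ nv ler_pdivrMl// mulr1.
Qed.

(** The trace is the sum of [<a, B a>] over the columns [a] of [A ^t*], and Cauchy-Schwarz bounds
    each term. With a state written as [A ^t* *m A], this says that expectations are at most the
    norm. *)
Lemma normc_trace_le A B c : opbound c B ->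
  normc (\tr (A ^t* *m A *m B)) <= c * complex.Re (\tr (A ^t* *m A)).
Proof.
move=> hB.
have E : \tr (A ^t* *m A *m B) = \sum_i ((col i (A ^t*)) ^t* *m (B *m col i (A ^t*))) 0 0.
  rewrite -mulmxA mxtrace_mulC /mxtrace; apply: eq_bigr => i _.
  rewrite -mulmxA !mxE; apply: eq_bigr => j _; rewrite !mxE; congr (_ * _).
    by rewrite conjCK.
  by apply: eq_bigr => k _; rewrite !mxE.
have E' : \tr (A ^t* *m A) = \sum_i ((vnorm (col i (A ^t*))) ^+ 2)%:C.
  rewrite mxtrace_mulC /mxtrace; apply: eq_bigr => i _; rewrite sqr_vnorm.
  by rewrite !mxE; apply: eq_bigr => j _; rewrite !mxE conjCK.
rewrite E' -rmorph_sum /= mulr_sumr -lecR -normr_normc E.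
rewrite (le_trans (ler_norm_sum _ _ _))// rmorph_sum /=.
apply: ler_sum => i _; rewrite normr_normc lecR (le_trans (cauchy_schwarz _ _))//.
by rewrite expr2 mulrCA ler_wpM2l ?vnorm_ge0.
Qed.

End Norms.

(** * Gram factorisation of density operators and product states *)

Section States.
Variables (R : realType) (d : nat) (V : finType).

(** By the spectral theorem the factor can be taken as the square root of the eigenvalues times the
    diagonalising unitary. *)
Lemma density_factor n (A : 'M[R[i]]_n) : density A ->
  exists M : 'M[R[i]]_n, A = M ^t* *m M.
Proof.
case=> hA pA _; have /hermitian_normalmx/orthomx_spectralP AE := hA.
set P := spectralmx A in AE; set D := spectral_diag A in AE.
have PU : P \is unitarymx := spectral_unitarymx A.
have Pinv : invmx P = P ^t* by rewrite invmx_unitary.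
have PP : P *m P ^t* = 1%:M by apply/unitarymxP.
(* Positivity tested on the [j]-th eigenvector, the adjoint of [row j P], isolates the [j]-th
   eigenvalue. *)
have D0 j : 0 <= D 0 j.
  have := pA ((row j P) ^t*); rewrite trmxCK.
  rewrite AE Pinv !mulmxA -row_mul PP -!mulmxA.
  have -> : P *m (row j P) ^t* = col j (1%:M).
    rewrite -PP; apply/matrixP => a b; rewrite !mxE; apply: eq_bigr => k _.
    by rewrite !mxE.
  rewrite mulmxA row1 -rowE mxE (bigD1 j)//= big1 => [|k kj].
    by rewrite !mxE eqxx mulr1 addr0.
  by rewrite !mxE (negPf kj) mulr0.
pose Q := diag_mx (\row_j sqrtC (D 0 j)).
exists (Q *m P); rewrite adj_mulmx AE Pinv !mulmxA; congr (_ *m _).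
rewrite -mulmxA; congr (_ *m _).
rewrite tr_diag_mx map_diag_mx mulmx_diag; congr (diag_mx _).
apply/rowP => j; rewrite !mxE -[LHS]sqrtCK expr2; congr (_ * _).
by apply/esym; apply: geC0_conj; rewrite sqrtC_ge0.
Qed.

Lemma product_op_adj (A_ : V -> 'M[R[i]]_d) :
  (product_op A_) ^t* = product_op (fun v => (A_ v) ^t*).
Proof.
apply: entry_inj => s s'; rewrite entry_of_entries /entry !mxE !enum_rankK rmorph_prod.
by apply: eq_bigr => v _; rewrite !mxE.
Qed.

Lemma product_opM (A_ B_ : V -> 'M[R[i]]_d) :
  product_op A_ *m product_op B_ = product_op (fun v => A_ v *m B_ v).
Proof.
apply: entry_inj => s s'; rewrite entryM entry_of_entries.
under [RHS]eq_bigr do rewrite mxE.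
rewrite bigA_distr_bigA; apply: eq_bigr => r _.
by rewrite !entry_of_entries -big_split.
Qed.

Lemma trace_product_op (A_ : V -> 'M[R[i]]_d) :
  \tr (product_op A_) = \prod_v \tr (A_ v).
Proof.
rewrite mxtrace_entry /mxtrace bigA_distr_bigA; apply: eq_bigr => s _.
by rewrite entry_of_entries.
Qed.

(** The Gram factor is chosen site by site: adjoints, products and traces of product operators are
    all computed at each site. *)
Lemma product_state_factor (rho : operator R V d) : product_state rho ->
  [/\ exists M : operator R V d, rho = M ^t* *m M,
      \tr rho = 1 &
      exists rho_ : V -> 'M[R[i]]_d, rho = product_op rho_].
Proof.
case=> rho_ D E; split; last by exists rho_.
  pose M v := projT1 (cid (density_factor (D v))).
  have ME v : rho_ v = (M v) ^t* *m M v by rewrite /M; case: cid.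
  exists (product_op M); rewrite product_op_adj product_opM E.
  by congr product_op; apply/funext => v; exact: ME.
by rewrite E trace_product_op big1// => v _; case: (D v).
Qed.

End States.

(** * Moments of sums of local operators *)

Section Moments.
Variables (R : realType) (d : nat) (V : finType) (I : finType).
Variables (rho : operator R V d) (b : I -> operator R V d) (w : I -> R).
Variable supp : I -> {set V}.
Hypothesis hrho : product_state rho.
Hypothesis b_local : forall i, local (supp i) (b i).
Hypothesis b_bound : forall i, opbound (w i) (b i).
Hypothesis b_mean : forall i, \tr (rho *m b i) = 0.
Hypothesis w_ge0 : forall i, 0 <= w i.

Definition meets (i j : I) := supp i :&: supp j != finset.set0.

Lemma trace_state_le A c : opbound c A -> normc (\tr (rho *m A)) <= c.
Proof.
move=> hA; have [[M rhoE] tr1 _] := product_state_factor hrho.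
by have := normc_trace_le M hA; rewrite -rhoE tr1 /= mulr1.
Qed.

(** The isolated factor commutes past those before it, whose supports avoid its own; the product
    state then factorises and the centred factor has mean zero. *)
Lemma trace_isolated n (g : {ffun 'I_n -> I}) : ~~ covered meets g ->
  \tr (rho *m \prod_i b (g i)) = 0.
Proof.
case/forallPn => i /existsPn iso.
have lother j : j != i -> local (~: supp (g i)) (b (g j)).
  move=> ji; apply: local_sub (b_local _); have := iso j.
  by rewrite ji /= negbK finset.setI_eq0 finset.disjoints_subset.
have [_ tr1 [rho_ rhoE]] := product_state_factor hrho.
have lprod (l : seq 'I_n) : i \notin l -> local (~: supp (g i)) (\prod_(k <- l) b (g k)).
  elim: l => [|k l IH]; first by rewrite big_nil => _; exact: local1.
  rewrite inE negb_or big_cons => /andP[ik il]; apply: localM; last exact: IH.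
  by apply: lother; rewrite eq_sym.
have : i \in index_enum 'I_n by rewrite mem_index_enum.
have := index_enum_uniq 'I_n; move: (index_enum _) => l ul il.
case/splitPr: il ul => l1 l2; rewrite uniq_catC /= mem_cat negb_or => /andP[/andP[i2 i1] _].
rewrite big_cat big_cons /=.
set P := \prod_(k <- l1) _; set Q := \prod_(k <- l2) _.
have -> : P * (b (g i) * Q) = b (g i) *m (P *m Q).
  by rewrite mulrA -mulmxE -(local_comm (b_local (g i)) (lprod l1 i1)) mulmxA.
have := tr_product_op_mul rho_ (b_local (g i)) (localM (lprod l1 i1) (lprod l2 i2)).
by rewrite -rhoE tr1 mulr1 b_mean mul0r.
Qed.

Lemma moment_le n :
  normc (\tr (rho *m (\sum_i b i) ^+ n)) <=
  \sum_(g : {ffun 'I_n -> I} | covered meets g) \prod_i w (g i).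
Proof.
have -> : (\sum_i b i) ^+ n = \sum_(g : {ffun 'I_n -> I}) \prod_i b (g i).
  by rewrite -(bigA_distr_bigA (fun _ => b)) prodr_const card_ord.
rewrite mulmx_sumr raddf_sum /= (bigID (fun g => covered meets g)) /=.
rewrite [X in _ + X]big1 ?addr0; last first.
  by move=> g; exact: trace_isolated.
rewrite -lecR -normr_normc (le_trans (ler_norm_sum _ _ _))// rmorph_sum /=.
apply: ler_sum => g _; rewrite normr_normc lecR; apply: trace_state_le.
by apply: opbound_prod => // i _.
Qed.

End Moments.

(** * Cluster expansion of iterated commutators *)

Section ClusterExpansion.
Variables (R : realType) (d : nat) (V : finType) (S : {set {set V}}).
Variables g1 g2 : {set V} -> operator R V d.
Hypothesis g1_local : forall X, X \in S -> local X (g1 X).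
Hypothesis g2_local : forall X, X \in S -> local X (g2 X).
Hypothesis g1_bound : forall X, X \in S -> opbound 1 (g1 X).
Hypothesis g2_bound : forall X, X \in S -> opbound 1 (g2 X).
Local Notation T := {set {set V}}.
Local Notation D := (max_degree S).
Implicit Types (X Y : {set V}) (Z : T).

(* Empty outside S, so that every bound below may range over all Z. *)
Definition cluster_supp (Z : T) : {set V} :=
  if Z \subset S then finset.cover Z else finset.set0.

(** One commutator step. [Y] may already belong to [Z], in which case the cluster stays the same
    while the order rises. *)
Definition grows (Y : {set V}) (Z Z' : T) :=
  (Y |: Z == Z') && (Y :&: cluster_supp Z != finset.set0).

Definition commutator (A B : operator R V d) := A *m B - B *m A.

(** The part of the [n]-fold nested commutator in which the subsystems used form exactly the set
    [Z']. *)
Fixpoint cluster_op n (Z' : T) : operator R V d :=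
  if n is n.+1 then
    \sum_(Y in S) \sum_(Z | grows Y Z Z') commutator (g1 Y) (cluster_op n Z)
  else \sum_(X in S | Z' == [set X]%SET) g2 X.

(** The recursion of [cluster_op] with every local term replaced by its norm bound 1 and every
    commutator by a factor 2. *)
Fixpoint cluster_weight n (Z' : T) : R :=
  if n is n.+1 then
    \sum_(Y in S) \sum_(Z | grows Y Z Z') 2 * cluster_weight n Z
  else \sum_(X in S | Z' == [set X]%SET) 1.

Lemma cluster_weightS n Z' : cluster_weight n.+1 Z' =
  \sum_(Y in S) \sum_(Z | grows Y Z Z') 2 * cluster_weight n Z.
Proof. by []. Qed.

Lemma cluster_supp_cons Y Z : Y \in S -> Z \subset S ->
  cluster_supp (Y |: Z) = Y :|: cluster_supp Z.
Proof.
move=> YS ZS; rewrite /cluster_supp ZS finset.subUset finset.sub1set YS ZS.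
by rewrite /finset.cover finset.bigcup_setU big_set1.
Qed.

Lemma grows_sub Y Z Z' : grows Y Z Z' -> Z \subset S.
Proof.
by case/andP => _; rewrite /cluster_supp; case: ifP => //; rewrite finset.setI0 eqxx.
Qed.

Lemma cluster_weight_ge0 n Z : 0 <= cluster_weight n Z.
Proof.
elim: n Z => [|n IH] Z /=; first exact: sumr_ge0.
by apply: sumr_ge0 => Y _; apply: sumr_ge0 => Z0 _; rewrite mulr_ge0.
Qed.

(** A cluster consists of the initial subsystem and at most one further subsystem for each
    commutator. *)
Lemma cluster_weight_supp n Z : cluster_weight n Z != 0 ->
  [/\ Z \subset S, Z != finset.set0 & (#|Z| <= n.+1)%N].
Proof.
elim: n Z => [|n IH] Z'.
  apply: contraNP => H; apply/eqP; apply: big1 => X /andP[XS /eqP ZX].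
  by case: H; rewrite ZX finset.sub1set XS cards1 -card_gt0 cards1.
rewrite cluster_weightS; apply: contraNP => H; apply/eqP.
apply: big1 => Y YS; apply: big1 => Z gr.
have [->|/IH[ZS Z0 cZ]] := eqVneq (cluster_weight n Z) 0; first by rewrite mulr0.
case: H; case/andP: gr => /eqP <- _; split.
- by rewrite finset.subUset finset.sub1set YS ZS.
- by apply/finset.set0Pn; exists Y; rewrite !inE eqxx.
- by rewrite cardsU1 (leq_trans (leq_add (leq_b1 _) cZ)).
Qed.

Lemma opbound_commutator A B c : 0 <= c -> opbound 1 A -> opbound c B ->
  opbound (2 * c) (commutator A B).
Proof.
move=> c0 hA hB; have -> : 2 * c = 1 * c + c * 1 by ring.
by apply: opboundD; [exact: opboundM | apply: opboundN; exact: opboundM].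
Qed.

Lemma cluster_op_bound n Z : opbound (cluster_weight n Z) (cluster_op n Z).
Proof.
elim: n Z => [|n IH] Z /=; first by apply: opbound_sum => X /andP[XS _]; exact: g2_bound.
apply: opbound_sum => Y YS; apply: opbound_sum => Z0 _.
by apply: opbound_commutator; rewrite ?cluster_weight_ge0//; exact: g1_bound.
Qed.

Lemma cluster_op_local n Z : local (cluster_supp Z) (cluster_op n Z).
Proof.
elim: n Z => [|n IH] Z' /=.
  apply: local_sum => X /andP[XS /eqP ->];
  rewrite /cluster_supp finset.sub1set XS /finset.cover big_set1.
  exact: g2_local.
apply: local_sum => Y YS; apply: local_sum => Z gr; have ZS := grows_sub gr.
case/andP: gr => /eqP <- _; rewrite cluster_supp_cons//.
have l1 : local (Y :|: cluster_supp Z) (g1 Y).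
  by apply: local_sub (g1_local YS); exact: finset.subsetUl.
have l2 : local (Y :|: cluster_supp Z) (cluster_op n Z).
  by apply: local_sub (IH Z); exact: finset.subsetUr.
by apply: localD; [|apply: localN]; exact: localM.
Qed.

(** Keeping only growth steps loses nothing, since a term [g1 Y] whose subsystem misses the support
    of the cluster commutes with it. *)
Lemma sum_cluster_op n :
  \sum_Z cluster_op n Z =
  iter n (commutator (\sum_(Y in S) g1 Y)) (\sum_(X in S) g2 X).
Proof.
elim: n => [|n IH] /=.
  rewrite (exchange_big_dep (mem S)) /=; last by move=> ? ? _ /andP[].
  by apply: eq_bigr => X XS; under eq_bigl do rewrite XS; rewrite big_pred1_eq.
rewrite -IH exchange_big /commutator mulmx_suml mulmx_sumr -sumrB /=.
apply: eq_bigr => Y YS; rewrite mulmx_sumr mulmx_suml -sumrB.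
rewrite (exchange_big_dep predT)//=; apply: eq_bigr => Z _.
rewrite /grows; have [dis|] := eqVneq (Y :&: cluster_supp Z) finset.set0; last first.
  by move=> _; under eq_bigl do rewrite andbT eq_sym; rewrite big_pred1_eq.
rewrite big_pred0; last by move=> Z'; rewrite andbF.
rewrite (local_comm (g1_local YS)) ?subrr//; apply: local_sub (cluster_op_local n Z).
by rewrite -finset.disjoints_subset disjoint_sym -finset.setI_eq0 dis.
Qed.

(** The extra one accounts for [Y] itself, which [interact] excludes. *)
Lemma card_neighbours Y : Y \in S ->
  (#|[set Y' in S | Y :&: Y' != finset.set0]%SET| <= D.+1)%N.
Proof.
move=> YS; apply: (@leq_trans #|Y |: [set Y' in S | interact Y Y']|%SET).
  apply/subset_leq_card/fintype.subsetP => Y'; rewrite !inE /interact => /andP[-> ->].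
  by rewrite andbT eq_sym orbN.
rewrite cardsU1 -add1n leq_add ?leq_b1//.
exact: (@leq_bigmax_cond _ (mem S) (fun X => #|[set Y' in S | interact X Y']%SET|)).
Qed.

Lemma cluster_supp_meets Z Y : Y :&: cluster_supp Z != finset.set0 ->
  exists X, [/\ X \in Z, X \in S & X :&: Y != finset.set0].
Proof.
rewrite /cluster_supp; case: ifP => ZS; last by rewrite finset.setI0 eqxx.
case/finset.set0Pn => v; rewrite inE => /andP[vY /finset.bigcupP[X XZ vX]].
exists X; split => //; first exact: (fintype.subsetP ZS).
by apply/finset.set0Pn; exists v; rewrite inE vX.
Qed.

(** A cluster whose support meets [Y0] contains one of the at most [D + 1] subsystems meeting [Y0];
    a union bound follows. *)
Lemma sum_neighbours (f : T -> R) (c : R) Y0 : (forall Z, 0 <= f Z) -> 0 <= c ->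
    Y0 \in S -> (forall Y, Y \in S -> \sum_(Z : T | Y \in Z) f Z <= c) ->
  \sum_(Z : T | Y0 :&: cluster_supp Z != finset.set0) f Z <= D.+1%:R * c.
Proof.
move=> f0 c0 Y0S H.
apply: (@le_trans _ _ (\sum_(Y in [set Y' in S | Y0 :&: Y' != finset.set0]%SET)
                         \sum_(Z : T | Y \in Z) f Z)).
  rewrite (exchange_big_dep predT)//= [leLHS]big_mkcond; apply: ler_sum => Z _.
  case: ifP => [|_]; last exact: sumr_ge0.
  case/cluster_supp_meets => X [XZ XS XY0].
  by rewrite (bigD1 X) ?inE ?XZ ?XS 1?finset.setIC ?XY0//= lerDl sumr_ge0.
apply: le_trans (_ : \sum_(Y in [set Y' in S | Y0 :&: Y' != finset.set0]%SET) c <= _).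
  by apply: ler_sum => Y; rewrite inE => /andP[YS _]; exact: H.
by rewrite sumr_const -[c *+ _]mulr_natl ler_wpM2r// ler_nat card_neighbours.
Qed.

Lemma card_growth Z : Z \subset S ->
  (#|[set Y in S | Y :&: cluster_supp Z != finset.set0]%SET| <= #|Z| * D.+1)%N.
Proof.
move=> ZS.
apply: (@leq_trans #|\bigcup_(X in Z) [set Y in S | X :&: Y != finset.set0]|%SET).
  apply/subset_leq_card/fintype.subsetP => Y; rewrite !inE => /andP[YS].
  case/cluster_supp_meets => X [XZ XS XY]; apply/finset.bigcupP; exists X => //.
  by rewrite inE YS.
apply: (@leq_trans (\sum_(X in Z) #|[set Y in S | X :&: Y != finset.set0]|%SET)).
  elim/big_ind2: _ => [|A a B b hA hB|//]; first by rewrite cards0.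
  exact: leq_trans (leq_card_setU _ _) (leq_add hA hB).
rewrite -sum_nat_const; apply: leq_sum => X XZ; apply: card_neighbours.
exact: (fintype.subsetP ZS).
Qed.

(** Induction on the order. If [Y0] is already in [Z], there are at most [(n + 1)(D + 1)] subsystems
    to adjoin; otherwise the new one is [Y0] itself and [Z] meets it, which [sum_neighbours] bounds.
    Together these give the factor [2 (n + 2)(D + 1)]. *)
Lemma sum_cluster_weight n Y0 : Y0 \in S ->
  \sum_(Z : T | Y0 \in Z) cluster_weight n Z <= n.+1`!%:R * (2 * D.+1%:R) ^+ n.
Proof.
elim: n Y0 => [|n IH] Y0 Y0S.
  rewrite expr0 mulr1 /= (exchange_big_dep (mem S)) /=; last by move=> ? ? _ /andP[].
  rewrite (bigD1 Y0)//= [X in _ + X]big1 ?addr0; last first.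
    move=> X /andP[_ XY]; apply: big1 => Z /andP[ZY /andP[_ /eqP ZX]].
    by move: ZY; rewrite ZX inE eq_sym (negPf XY).
  rewrite (bigD1 [set Y0]%SET) /=; last by rewrite inE !eqxx Y0S.
  by rewrite big1 ?addr0// => Z /andP[/andP[_ /andP[_ ->]]].
pose W : R := n.+1`!%:R * (2 * D.+1%:R) ^+ n.
have W0 : 0 <= W by rewrite mulr_ge0 ?exprn_ge0 ?mulr_ge0.
have -> : n.+2`!%:R * (2 * D.+1%:R) ^+ n.+1 =
    2 * (n.+1%:R * D.+1%:R * W + D.+1%:R * W) :> R.
  by rewrite /W factS natrM exprS -[n.+2%:R]natr1; ring.
under eq_bigr do rewrite cluster_weightS.
rewrite (exchange_big_dep (mem S)) //=.
under eq_bigr => Y YS do rewrite (exchange_big_dep predT)//=.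
rewrite exchange_big /=.
apply: (@le_trans _ _ (\sum_Z (2 * cluster_weight n Z *
   ((Y0 \in Z)%:R * (n.+1%:R * D.+1%:R) + (Y0 :&: cluster_supp Z != finset.set0)%:R)))).
  apply: ler_sum => Z _.
  have [->|wZ] := eqVneq (cluster_weight n Z) 0.
    by rewrite mulr0 mul0r big1// => Y _; rewrite big1.
  have [ZS Z0 cZ] := cluster_weight_supp wZ.
  have -> : \sum_(Y in S) \sum_(Z' : T | (Y0 \in Z') && (Y \in S) && grows Y Z Z')
         2 * cluster_weight n Z
     = \sum_(Y in S | (Y0 \in Y |: Z) && (Y :&: cluster_supp Z != finset.set0))
         2 * cluster_weight n Z.
    rewrite [RHS]big_mkcondr; apply: eq_bigr => Y YS; rewrite YS /grows.
    case: ifPn => [/andP[h1 h2]|h].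
      rewrite (big_pred1 (Y |: Z)) // => Z' /=.
      by rewrite h2 !andbT [RHS]eq_sym; apply: andb_idl => /eqP <-.
    rewrite big_pred0// => Z'; apply: contraNF h.
    by move=> /andP[/andP[h1 _] /andP[/eqP -> ->]]; rewrite h1.
  rewrite sumr_const -[(2 * cluster_weight n Z) *+ _]mulr_natr.
  rewrite ler_wpM2l ?mulr_ge0 ?cluster_weight_ge0//.
  rewrite -!natrM -natrD ler_nat.
  have cardG := leq_trans (card_growth ZS) (leq_mul cZ (leqnn D.+1)).
  case: (boolP (Y0 \in Z)) => Y0Z.
    rewrite mul1n; apply: leq_trans (leq_addr _ _); apply: leq_trans cardG.
    apply/subset_leq_card/fintype.subsetP => Y; rewrite !inE /= => /andP[YS /andP[_ h]].
    by rewrite YS.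
  rewrite mul0n add0n; case: eqVneq => /= h.
    rewrite leqn0; apply/eqP; apply: eq_card0 => Y; apply/negbTE/negP.
    rewrite unfold_in /= !inE (negPf Y0Z) orbF.
    by move=> /andP[YS /andP[/eqP <-]]; rewrite h eqxx.
  rewrite -(cards1 Y0); apply/subset_leq_card/fintype.subsetP => Y.
  move=> /andP[YS /andP[]]; rewrite !inE (negPf Y0Z) orbF.
  by move=> /eqP ->.
under eq_bigr do rewrite mulrDr.
rewrite big_split /= mulrDr lerD//.
  under eq_bigr do rewrite mulrA (mulrAC 2) -!mulrA.
  rewrite -mulr_sumr ler_wpM2l//.
  under eq_bigr do rewrite mulrA.
  rewrite -mulr_suml mulrC ler_wpM2l//.
  rewrite (le_trans _ (IH _ Y0S))// [leRHS]big_mkcond; apply: ler_sum => Z _.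
  by case: (Y0 \in Z); rewrite ?mul1r ?mul0r.
under eq_bigr do rewrite -mulrA.
rewrite -mulr_sumr ler_wpM2l//.
rewrite (le_trans _ (sum_neighbours (cluster_weight_ge0 n) W0 Y0S IH))//.
rewrite [leRHS]big_mkcond; apply: ler_sum => Z _.
by case: (_ != _); rewrite ?mulr1 ?mulr0.
Qed.

End ClusterExpansion.

(** * The matrix exponential *)

Section EntryNorm.
Variable R : realType.

Lemma cvg_sumr (I : Type) (r : seq I) (f : I -> nat -> R) (a : I -> R) :
  (forall i, f i @ \oo --> a i) ->
  (fun N => \sum_(i <- r) f i N) @ \oo --> \sum_(i <- r) a i.
Proof.
move=> fa; elim: r => [|i r IH].
  by rewrite big_nil; under eq_fun do rewrite big_nil; exact: cvg_cst.
by rewrite big_cons; under eq_fun do rewrite big_cons; exact: cvgD.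
Qed.

(** Limits are taken in this norm because it is submultiplicative, unlike the maximum of the
    entries. *)
Definition norm1 n (A : 'M[R[i]]_n) : R := \sum_i \sum_j normc (A i j).

Lemma ler_normc_sum (I : Type) (r : seq I) (P : pred I) (F : I -> R[i]) :
  normc (\sum_(i <- r | P i) F i) <= \sum_(i <- r | P i) normc (F i).
Proof. by rewrite -lecR -normr_normc rmorph_sum /=; exact: ler_norm_sum. Qed.

Variable n : nat.
Implicit Types A B : 'M[R[i]]_n.

Lemma norm1_ge0 A : 0 <= norm1 A.
Proof. by apply: sumr_ge0 => i _; apply: sumr_ge0 => j _; exact: normc_ge0. Qed.

Lemma norm1_entry A i j : normc (A i j) <= norm1 A.
Proof.
rewrite /norm1 (bigD1 i)//= (bigD1 j)//= -addrA lerDl addr_ge0 ?sumr_ge0// => k _.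
  exact: normc_ge0.
by apply: sumr_ge0 => l _; exact: normc_ge0.
Qed.

Lemma norm1D A B : norm1 (A + B) <= norm1 A + norm1 B.
Proof.
rewrite /norm1 -big_split; apply: ler_sum => i _; rewrite -big_split.
by apply: ler_sum => j _; rewrite mxE ler_normcD.
Qed.

Lemma norm1Z c A : norm1 (c *: A) = normc c * norm1 A.
Proof.
rewrite /norm1 mulr_sumr; apply: eq_bigr => i _; rewrite mulr_sumr.
by apply: eq_bigr => j _; rewrite mxE ComplexField.Normc.normcM.
Qed.

Lemma norm1N A : norm1 (- A) = norm1 A.
Proof.
by apply: eq_bigr => i _; apply: eq_bigr => j _; rewrite mxE normcN.
Qed.

Lemma norm1_0 : norm1 (0 : 'M[R[i]]_n) = 0.
Proof. by rewrite -(scale0r 0) norm1Z ComplexField.Normc.normc0 mul0r. Qed.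

Lemma norm1M A B : norm1 (A *m B) <= norm1 A * norm1 B.
Proof.
rewrite {2}/norm1 mulr_suml; apply: ler_sum => i _.
apply: (@le_trans _ _ (\sum_j \sum_k normc (A i k) * normc (B k j))).
  apply: ler_sum => j _; rewrite mxE (le_trans (ler_normc_sum _ _ _))//.
  by apply: ler_sum => k _; rewrite ComplexField.Normc.normcM.
rewrite exchange_big mulr_suml; apply: ler_sum => k _.
rewrite -mulr_sumr ler_wpM2l ?normc_ge0// /norm1 [leRHS](bigD1 k)//= lerDl.
by apply: sumr_ge0 => j _; apply: sumr_ge0 => l _; exact: normc_ge0.
Qed.

Lemma norm1_sum (I : Type) (r : seq I) (P : pred I) (F : I -> 'M[R[i]]_n) :
  norm1 (\sum_(i <- r | P i) F i) <= \sum_(i <- r | P i) norm1 (F i).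
Proof.
elim/big_ind2: _ => [|A a B b hA hB|//]; first by rewrite norm1_0.
by rewrite (le_trans (norm1D _ _))// lerD.
Qed.

Lemma norm1_adj A : norm1 (A ^t*) = norm1 A.
Proof.
rewrite /norm1 exchange_big; apply: eq_bigr => i _; apply: eq_bigr => j _.
rewrite !mxE; apply/complexI; rewrite -!normr_normc.
exact: norm_conjC.
Qed.

Lemma norm1_trace A : normc (\tr A) <= norm1 A.
Proof.
rewrite (le_trans (ler_normc_sum _ _ _))//; apply: ler_sum => i _.
by rewrite (bigD1 i)//= lerDl sumr_ge0// => j _; exact: normc_ge0.
Qed.

Definition mx_cvg (u : nat -> 'M[R[i]]_n) (l : 'M[R[i]]_n) :=
  (fun N => norm1 (u N - l)) @ \oo --> (0 : R).

Lemma mx_cvg_le (u : nat -> 'M[R[i]]_n) l (a : nat -> R) :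
  (forall N, norm1 (u N - l) <= a N) -> a @ \oo --> (0 : R) -> mx_cvg u l.
Proof.
move=> ua a0; apply: (squeeze_cvgr _ (cvg_cst 0) a0).
by near=> N; rewrite norm1_ge0 ua.
Unshelve. all: by end_near. Qed.

Lemma mx_cvg_cst l : mx_cvg (fun=> l) l.
Proof.
apply: (mx_cvg_le (a := fun=> 0)) => [N|]; last exact: cvg_cst.
by rewrite subrr norm1_0.
Qed.

Lemma mx_cvgM u v l m : mx_cvg u l -> mx_cvg v m -> mx_cvg (fun N => u N *m v N) (l *m m).
Proof.
move=> ul vm; apply: (mx_cvg_le (a := fun N => norm1 (u N - l) * (norm1 (v N - m) + norm1 m)
   + norm1 l * norm1 (v N - m))).
  move=> N; have -> : u N *m v N - l *m m =
      (u N - l) *m ((v N - m) + m) + l *m (v N - m).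
    by rewrite subrK mulmxBl mulmxBr addrA subrK.
  rewrite (le_trans (norm1D _ _))// lerD// ?norm1M//.
  by rewrite (le_trans (norm1M _ _))// ler_wpM2l ?norm1_ge0 ?norm1D.
have -> : 0 = 0 * (0 + norm1 m) + norm1 l * 0 :> R by rewrite mul0r mulr0 addr0.
apply: cvgD; first by apply: cvgM => //; apply: cvgD => //; exact: cvg_cst.
by apply: cvgM => //; exact: cvg_cst.
Qed.

Lemma mx_cvgX u l m : mx_cvg u l -> mx_cvg (fun N => u N ^+ m) (l ^+ m).
Proof.
move=> ul; elim: m => [|m IH]; first exact: mx_cvg_cst.
have -> : (fun N => u N ^+ m.+1) = (fun N => u N *m u N ^+ m).
  by apply/funext => N; rewrite exprS.
by rewrite exprS; exact: mx_cvgM.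
Qed.

Lemma mx_cvg_adj u l : mx_cvg u l -> mx_cvg (fun N => (u N) ^t*) (l ^t*).
Proof.
move=> ul; apply: mx_cvg_le ul => N.
have -> : (u N) ^t* - l ^t* = (u N - l) ^t* by apply/matrixP => i j; rewrite !mxE rmorphB.
by rewrite norm1_adj.
Qed.

Lemma mx_cvg_unique u l m : mx_cvg u l -> mx_cvg u m -> l = m.
Proof.
move=> ul um; have z : norm1 (l - m) = 0.
  apply/eqP; rewrite eq_le norm1_ge0 andbT.
  have H : (fun N => norm1 (u N - l) + norm1 (u N - m)) @ \oo --> (0 : R).
    by rewrite -[0]addr0; exact: cvgD.
  rewrite -(cvg_lim (@Rhausdorff R) H).
  apply: limr_ge; first by apply/cvg_ex; exists 0.
  apply: nearW => N; have -> : l - m = - (u N - l) + (u N - m) by rewrite opprB addrA subrK.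
  by rewrite (le_trans (norm1D _ _))// norm1N.
apply/eqP; rewrite -subr_eq0; apply/eqP/matrixP => i j; rewrite mxE [RHS]mxE.
apply: ComplexField.Normc.eq0_normc; apply/eqP; rewrite eq_le normc_ge0 andbT.
by have := norm1_entry (l - m) i j; rewrite z mxE.
Qed.

Local Notation K := (R[i] : numFieldType).

(** [expm] is a limit for the maximum of the entries; this lemma and its converse pass between that
    topology and [norm1]. *)
Lemma mx_cvg_cvg (u : nat -> 'M[K]_n) (l : 'M[K]_n) : mx_cvg u l -> u @ \oo --> l.
Proof.
move=> ul; apply/cvgrPdist_lt => /= e e0.
have e0' : 0 < complex.Re e by move: (e0); rewrite ltcE => /andP[].
have eE : e = (complex.Re e)%:C by rewrite RRe_real// ger0_real// ltW.
move/cvgrPdist_lt : ul => /(_ _ e0') ul; near=> N.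
have H : norm1 (u N - l) < complex.Re e.
  have : `|0 - norm1 (u N - l)| < complex.Re e by near: N.
  by rewrite sub0r normrN ger0_norm ?norm1_ge0.
suff : ball l e (u N) by rewrite mx_norm_ball.
split=> // i j; rewrite /ball /= eE distrC normr_normc ltcR.
by apply: le_lt_trans H; have := norm1_entry (u N - l) i j; rewrite !mxE.
Unshelve. all: by end_near. Qed.

Lemma cvg_mx_cvg (u : nat -> 'M[K]_n) (l : 'M[K]_n) : u @ \oo --> l -> mx_cvg u l.
Proof.
move=> ul; rewrite /mx_cvg /norm1.
rewrite [X in _ --> X](_ : 0 = \sum_(i < n) \sum_(j < n) 0); last first.
  by rewrite big1// => i _; rewrite big1.
apply: (cvg_sumr (f := fun i N => \sum_j normc ((u N - l) i j))) => i.
apply: (cvg_sumr (f := fun j N => normc ((u N - l) i j))) => j.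
have uij : (fun N => u N i j) @ \oo --> l i j.
  exact: (continuous_cvg _ (@coord_continuous K n n i j l) ul).
apply/cvgrPdist_lt => e e0; have e0' : 0 < e%:C :> K by rewrite ltcR.
move/cvgrPdist_lt : uij => /(_ _ e0') uij; near=> N.
rewrite sub0r normrN ger0_norm ?normc_ge0// -ltcR -normr_normc !mxE distrC.
by near: N.
Unshelve. all: by end_near. Qed.

End EntryNorm.

(** * The exponential series, its inverse and adjoint, and conjugation by it *)

Section Expm.
Variables (R : realType) (n : nat).
Implicit Types A B : 'M[R[i]]_n.

Lemma Re_sum (I : Type) (r : seq I) (F : I -> R[i]) :
  complex.Re (\sum_(i <- r) F i) = \sum_(i <- r) complex.Re (F i).
Proof. by elim/big_rec2: _ => // i x y _ <-; case: (F i) => a b; case: y. Qed.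

Lemma Im_sum (I : Type) (r : seq I) (F : I -> R[i]) :
  complex.Im (\sum_(i <- r) F i) = \sum_(i <- r) complex.Im (F i).
Proof. by elim/big_rec2: _ => // i x y _ <-; case: (F i) => a b; case: y. Qed.

Lemma Re_le_normc (z : R[i]) : `|complex.Re z| <= normc z.
Proof.
by case: z => a b /=; rewrite -(sqrtr_sqr a) ler_wsqrtr// lerDl sqr_ge0.
Qed.

Lemma Im_le_normc (z : R[i]) : `|complex.Im z| <= normc z.
Proof.
by case: z => a b /=; rewrite -(sqrtr_sqr b) ler_wsqrtr// lerDr sqr_ge0.
Qed.

Lemma normc_le_ReIm (z : R[i]) : normc z <= `|complex.Re z| + `|complex.Im z|.
Proof.
case: z => a b /=; rewrite -[leRHS]ger0_norm ?addr_ge0// -sqrtr_sqr ler_wsqrtr//.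
by rewrite sqrrD !real_normK ?num_real// addrAC lerDl mulrn_wge0// mulr_ge0.
Qed.

Definition expterm A k : 'M[R[i]]_n := (k`!%:R^-1 : R[i]) *: A ^+ k.

Lemma norm1X A k : norm1 (A ^+ k) <= norm1 (1%:M : 'M[R[i]]_n) * norm1 A ^+ k.
Proof.
elim: k => [|k IH]; first by rewrite !expr0 mulr1.
rewrite exprSr -[A ^+ k * A]/(A ^+ k *m A) exprSr mulrA.
by rewrite (le_trans (norm1M _ _))// ler_wpM2r ?norm1_ge0.
Qed.

Lemma normc_invfact k : normc (k`!%:R^-1 : R[i]) = k`!%:R^-1.
Proof.
apply/complexI; rewrite -normr_normc ger0_norm ?invr_ge0 ?ler0n//.
by rewrite fmorphV /= rmorph_nat.
Qed.

Lemma norm1_expterm A k :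
  norm1 (expterm A k) <= norm1 (1%:M : 'M[R[i]]_n) * exp_coeff (norm1 A) k.
Proof.
rewrite norm1Z normc_invfact /exp_coeff /= mulrA mulrC ler_wpM2r ?invr_ge0 ?ler0n//.
exact: norm1X.
Qed.

(** Real and imaginary parts of each entry converge absolutely, by comparison with the exponential
    series of [norm1 A]. The limit [l] is built from them first, since [limn] carries information
    only when convergence is known. *)
Lemma expm_cvg A : mx_cvg (fun N => \sum_(0 <= k < N) expterm A k) (expm A).
Proof.
have cvg_part (f : R[i] -> R) : (forall z, `|f z| <= normc z) ->
    forall i j, cvgn (series (fun k => f (expterm A k i j))).
  move=> f_le i j; apply: normed_cvg.
  apply: (@series_le_cvg _ _ (fun k => norm1 (1%:M : 'M[R[i]]_n) * exp_coeff (norm1 A) k)).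
  - by move=> k; exact: normr_ge0.
  - by move=> k; rewrite mulr_ge0 ?norm1_ge0 ?exp_coeff_ge0 ?norm1_ge0.
  - move=> k /=; rewrite (le_trans (f_le _))// (le_trans (norm1_entry _ i j))//.
    exact: norm1_expterm.
  - exact: is_cvg_seriesZ (is_cvg_series_exp_coeff _).
have cRe := cvg_part _ Re_le_normc; have cIm := cvg_part _ Im_le_normc.
pose l : 'M[R[i]]_n := \matrix_(i, j)
  Complex (limn (series (fun k => complex.Re (expterm A k i j))))
          (limn (series (fun k => complex.Im (expterm A k i j)))).
suff ul : mx_cvg (fun N => \sum_(0 <= k < N) expterm A k) l.
  by apply: cvg_mx_cvg; exact: (cvgP _ (mx_cvg_cvg ul)).
pose a i j N := `|series (fun k => complex.Re (expterm A k i j)) N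
                  - limn (series (fun k => complex.Re (expterm A k i j)))|
  + `|series (fun k => complex.Im (expterm A k i j)) N
                  - limn (series (fun k => complex.Im (expterm A k i j)))|.
apply: (@mx_cvg_le _ _ _ _ (fun N => \sum_i \sum_j a i j N)).
  move=> N; apply: ler_sum => i _; apply: ler_sum => j _.
  rewrite (le_trans (normc_le_ReIm _))// /a /series /= -Re_sum -Im_sum !mxE summxE.
  by case: (\sum_(_ <= _ < _) _).
rewrite [X in _ --> X](_ : 0 = \sum_(i < n) \sum_(j < n) 0); last first.
  by rewrite big1// => i _; rewrite big1.
apply: (cvg_sumr (f := fun i N => \sum_j a i j N)) => i.
apply: (cvg_sumr (f := fun j N => a i j N)) => j.
have cvg0 (u : nat -> R) : cvgn u -> (fun N => `|u N - limn u|) @ \oo --> (0 : R).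
  move=> cu; rewrite -[X in _ --> X](@normr0 R R); apply: cvg_norm.
  by rewrite -[X in _ --> X](subrr (limn u)); apply: cvgB => //; exact: cvg_cst.
by rewrite -[X in _ --> X]addr0; apply: cvgD; apply: cvg0.
Qed.

(** The triangle [j + k < N], summed along its diagonals or along its rows. *)
Lemma sum_triangle (W : zmodType) (F : nat -> nat -> W) N :
  \sum_(0 <= m < N) \sum_(0 <= j < m.+1) F j (m - j)%N =
  \sum_(0 <= j < N) \sum_(0 <= k < N - j) F j k.
Proof.
elim: N => [|N IH]; first by rewrite !big_geq.
rewrite big_nat_recr//= IH [in RHS]big_nat_recr//= subSnn big_nat1.
rewrite [in LHS]big_nat_recr//= subnn addrA; congr (_ + _).
rewrite -big_split; apply: eq_big_nat => j /andP[_ jN].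
by rewrite subSn ?(ltnW jN)// big_nat_recr.
Qed.

(** Left and right multiplication by [A] commute, so the commutator powers form the Cauchy product
    of two exponential series. The induction multiplies by [m + 1] and splits it as
    [j + (m + 1 - j)]. *)
Lemma ad_expand A B m : (m`!%:R^-1 : R[i]) *: iter m (fun C => A *m C - C *m A) B =
  \sum_(0 <= j < m.+1) expterm A j *m B *m expterm (- A) (m - j).
Proof.
elim: m => [|m IH].
  by rewrite big_nat1 /expterm fact0 !expr0 invr1 !scale1r mul1mx mulmx1.
have left k : k.+1%:R *: expterm A k.+1 = A *m expterm A k.
  rewrite /expterm scalerA factS natrM invfM mulrA divff ?pnatr_eq0// mul1r exprS.
  by rewrite -scalemxAr.
have right k : k.+1%:R *: expterm (- A) k.+1 = - (expterm (- A) k *m A).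
  rewrite /expterm scalerA factS natrM invfM mulrA divff ?pnatr_eq0// mul1r exprSr.
  by rewrite mulrN scalerN -scalemxAl.
have m0 : (m.+1%:R : R[i]) != 0 by rewrite pnatr_eq0.
apply: (scalerI m0); rewrite scalerA factS natrM invfM mulrA divff// mul1r /=.
rewrite scalerBr [_ *: (A *m _)]scalemxAr [_ *: (_ *m A)]scalemxAl IH.
have -> : m.+1%:R *: (\sum_(0 <= j < m.+2) expterm A j *m B *m expterm (- A) (m.+1 - j)) =
  \sum_(0 <= j < m.+2) (j%:R *: expterm A j) *m B *m expterm (- A) (m.+1 - j) +
  \sum_(0 <= j < m.+2) expterm A j *m B *m ((m.+1 - j)%:R *: expterm (- A) (m.+1 - j)).
  rewrite -big_split scaler_sumr; apply: eq_big_nat => j /andP[_ jm] /=.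
  move: (expterm A j) (expterm (- A) _) => E F.
  by rewrite -!scalemxAl -scalemxAr -scalerDl -natrD subnKC.
congr (_ + _).
  rewrite [RHS]big_nat_recl// mulr0n scale0r !mul0mx add0r mulmx_sumr.
  by apply: eq_big_nat => j _; rewrite left subSS !mulmxA.
rewrite [RHS]big_nat_recr//= subnn mulr0n scale0r mulmx0 addr0 mulmx_suml -sumrN.
apply: eq_big_nat => j /andP[_ jm].
by rewrite subSn// right mulmxN !mulmxA.
Qed.

(* The partial sums differ from the product of those of expm A and expm (- A) by
   terms with j + k >= N, whose norms sum to at most
   (\sum_(j < N) a^j/j!)^2 - \sum_(m < N) (2a)^m/m!. *)
Lemma expm_conj_cvg A B :
  mx_cvg (fun N => \sum_(0 <= m < N) (m`!%:R^-1 : R[i]) *: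
                   iter m (fun C => A *m C - C *m A) B)
       (expm A *m B *m expm (- A)).
Proof.
set a := norm1 A; set c := norm1 (1%:M : 'M[R[i]]_n).
have c0 : 0 <= c := norm1_ge0 _.
pose P N := \sum_(0 <= k < N) expterm A k; pose Q N := \sum_(0 <= k < N) expterm (- A) k.
have PQ : mx_cvg (fun N => P N *m B *m Q N) (expm A *m B *m expm (- A)).
  by apply: mx_cvgM; [apply: mx_cvgM; [exact: expm_cvg|exact: mx_cvg_cst]|exact: expm_cvg].
pose e := exp_coeff a.
pose f N := (\sum_(0 <= j < N) e j) * (\sum_(0 <= k < N) e k)
     - \sum_(0 <= m < N) exp_coeff (a + a) m.
have f0 : f @ \oo --> (0 : R).
  have cv (x : R) : (fun N => \sum_(0 <= j < N) exp_coeff x j) @ \oo --> expR x.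
    exact: is_cvg_series_exp_coeff.
  rewrite [X in _ --> X](_ : 0 = expR a * expR a - expR (a + a)); last first.
    by rewrite expRD subrr.
  have cvp (p q : nat -> R) (x y : R) : p @ \oo --> x -> q @ \oo --> y ->
      (fun N => p N * p N - q N) @ \oo --> x * x - y.
    by move=> px qy; apply: cvgB => //; apply: cvgM.
  exact: cvp (cv a) (cv (a + a)).
have split_sum (W : zmodType) (G : nat -> nat -> W) N :
    \sum_(0 <= j < N) \sum_(0 <= k < N) G j k =
    \sum_(0 <= m < N) \sum_(0 <= j < m.+1) G j (m - j)%N +
    \sum_(0 <= j < N) \sum_(N - j <= k < N) G j k.
  rewrite sum_triangle -big_split; apply: eq_big_nat => j _.
  by rewrite -big_cat_nat// leq_subr.
(* By the binomial theorem the terms with [j + k < N] of the double sum add up to the partial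
   exponential series of [a + a]. *)
have fE N : f N = \sum_(0 <= j < N) \sum_(N - j <= k < N) e j * e k.
  rewrite /f big_distrlr split_sum addrAC [X in X + _](_ : _ = 0) ?add0r//.
  apply/eqP; rewrite subr_eq0; apply/eqP; apply: eq_big_nat => m _.
  rewrite /exp_coeff /= exprDn mulr_suml big_mkord; apply: eq_bigr => j _.
  have jm : (j <= m)%N by rewrite -ltnS.
  rewrite -mulr_natr -(bin_fact jm) !natrM !invfM /e /exp_coeff /=.
  have b0 : ('C(m, j)%:R : R) != 0 by rewrite pnatr_eq0 -lt0n bin_gt0.
  have j0 : (j`!%:R : R) != 0 by rewrite pnatr_eq0 -lt0n fact_gt0.
  have k0 : ((m - j)`!%:R : R) != 0 by rewrite pnatr_eq0 -lt0n fact_gt0.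
  by field; rewrite b0 j0 k0.
apply: (@mx_cvg_le _ _ _ _ (fun N => norm1 (P N *m B *m Q N - expm A *m B *m expm (- A))
    + c * norm1 B * c * f N)); last first.
  rewrite -[X in _ --> X]addr0; apply: cvgD => //.
  by rewrite -[X in _ --> X](mulr0 (c * norm1 B * c)); apply: cvgM => //; exact: cvg_cst.
move=> N; set U := \sum_(0 <= m < N) _.
have PQE : P N *m B *m Q N = U + \sum_(0 <= j < N) \sum_(N - j <= k < N)
     expterm A j *m B *m expterm (- A) k.
  rewrite /P /Q mulmx_suml mulmx_suml.
  under eq_bigr do rewrite mulmx_sumr.
  rewrite split_sum; congr (_ + _); apply: eq_bigr => m _.
  by rewrite ad_expand.
set Z := \sum_(0 <= j < N) _ in PQE.
have -> : U = P N *m B *m Q N - Z by rewrite PQE addrK.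
rewrite addrAC (le_trans (norm1D _ _))// norm1N lerD// fE mulr_sumr /Z.
rewrite (le_trans (norm1_sum _ _ _))//; apply: ler_sum => j _.
rewrite (le_trans (norm1_sum _ _ _))// mulr_sumr; apply: ler_sum => k _.
have -> : c * norm1 B * c * (e j * e k) = (c * e j) * norm1 B * (c * e k) by ring.
have e0 m : 0 <= e m by exact/exp_coeff_ge0/norm1_ge0.
rewrite (le_trans (norm1M _ _))// ler_pM ?norm1_ge0//.
  by rewrite (le_trans (norm1M _ _))// ler_pM ?norm1_ge0// norm1_expterm.
by rewrite (le_trans (norm1_expterm _ _))// norm1N.
Qed.

(** Conjugation of the identity: all its commutators vanish, so the series of [expm_conj_cvg] is
    constantly 1 from its first term on. *)
Lemma expmN_mul A : expm A *m expm (- A) = 1%:M.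
Proof.
rewrite -[expm A]mulmx1; apply: mx_cvg_unique (expm_conj_cvg A 1%:M) _.
have ad0 m : iter m.+1 (fun C => A *m C - C *m A) 1%:M = 0.
  elim: m => [|m IH]; first by rewrite /= mulmx1 mul1mx subrr.
  by rewrite iterS IH mulmx0 mul0mx subrr.
apply: cvg_near_cst; near=> N; have N0 : (0 < N)%N by near: N; exact: nbhs_infty_gt.
rewrite -(prednK N0) big_nat_recl// fact0 invr1 scale1r big1 ?addr0 ?subrr ?norm1_0//.
by move=> m _; rewrite ad0 scaler0.
Unshelve. all: by end_near. Qed.

Lemma expm_adj A : (expm A) ^t* = expm (A ^t*).
Proof.
apply: mx_cvg_unique (mx_cvg_adj (expm_cvg A)) _.
have -> : (fun N => (\sum_(0 <= k < N) expterm A k) ^t*) =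
  (fun N => \sum_(0 <= k < N) expterm (A ^t*) k); last exact: expm_cvg.
apply/funext => N; rewrite adjmx_sum; apply: eq_bigr => k _.
rewrite /expterm adjmxZ; congr (_ *: _).
  by rewrite conjc_inv conjc_nat.
elim: k => [|k IH]; first by rewrite !expr0 trmx1 map_mx1.
by rewrite exprS exprSr -IH [X in X ^t*]/(A *m A ^+ k) adj_mulmx.
Qed.

End Expm.

(** * Measurement probabilities *)

Section Markov.
Variables (R : realType) (n : nat) (B : 'M[R[i]]_n).
Hypothesis hB : B \is hermsymmx.
Local Notation P := (eigenproj B).

Lemma trace_gram_ge0 (A : 'M[R[i]]_n) : 0 <= \tr (A *m A ^t*).
Proof.
apply: sumr_ge0 => i _; rewrite mxE; apply: sumr_ge0 => j _.
by rewrite !mxE mul_conjC_ge0.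
Qed.

Lemma hermsymmx_adj : B ^t* = B.
Proof. by have := hB; rewrite hermsymmxE => /eqP <-. Qed.

Lemma eigenproj_mull x : P x *m B = x *: P x.
Proof. by apply/eigenspaceP; rewrite -[P x]mul1mx proj_ortho_sub. Qed.

(** The adjoint of the left relation; comparing the two on a nonzero [P x] shows below that
    eigenvalues are real. *)
Lemma eigenproj_mulr x : B *m P x = x^*%C *: P x.
Proof.
rewrite -[LHS]trmxCK adj_mulmx eigenproj_herm hermsymmx_adj eigenproj_mull.
by rewrite adjmxZ eigenproj_herm.
Qed.

Lemma eigenvalue_herm_real x : eigenvalue B x -> x^*%C = x.
Proof.
move=> ev; have P0 : P x != 0.
  apply: contra ev => /eqP P0; rewrite /eigenspace.
  have := proj_orthoE (eigenspace B x); rewrite -/(eigenproj B x) P0 => E0.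
  by rewrite -submx0 -E0 sub0mx.
have : (x - x^*%C) *: P x = 0.
  have E1 : P x *m B *m P x = x *: P x by rewrite eigenproj_mull -scalemxAl eigenproj_idem.
  have E2 : P x *m B *m P x = x^*%C *: P x
    by rewrite -mulmxA eigenproj_mulr -scalemxAr eigenproj_idem.
  by rewrite scalerBl -E1 -E2 subrr.
by move/eqP; rewrite scaler_eq0 (negPf P0) orbF subr_eq0 => /eqP.
Qed.

Lemma eigenproj_ortho x y : eigenvalue B y -> x != y -> P x *m P y = 0.
Proof.
move=> ev xy; apply/eqP; have : (x - y) *: (P x *m P y) = 0.
  rewrite scalerBl scalemxAl -eigenproj_mull -mulmxA eigenproj_mulr.
  by rewrite eigenvalue_herm_real// -scalemxAr subrr.
by move/eqP; rewrite scaler_eq0 subr_eq0 (negPf xy).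
Qed.

(** The sum [Q] of eigenprojectors of distinct eigenvalues is an orthogonal projector, so the
    difference of the two sides is the trace of the Gram matrix of [D (1 - Q)]. *)
Lemma trace_eigenproj_le (l : seq R[i]) (D : 'M[R[i]]_n) : uniq l ->
  {in l, forall x, eigenvalue B x} ->
  \sum_(x <- l) \tr (D *m P x *m D ^t*) <= \tr (D *m D ^t*).
Proof.
move=> ul ev; pose Q := \sum_(x <- l) P x.
have QQ : Q *m Q = Q.
  rewrite /Q mulmx_suml big_seq [RHS]big_seq; apply: eq_bigr => x xl.
  rewrite mulmx_sumr (bigD1_seq x) //=.
  rewrite [X in _ + X]big1_seq => [|y /andP[yx yl]].
    by rewrite addr0; exact: eigenproj_idem.
  by apply: eigenproj_ortho; rewrite ?ev// eq_sym.
have Qh : Q ^t* = Q.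
  by rewrite /Q adjmx_sum; apply: eq_bigr => x _; exact: eigenproj_herm.
have -> : \sum_(x <- l) \tr (D *m P x *m D ^t*) = \tr (D *m Q *m D ^t*).
  by rewrite mulmx_sumr mulmx_suml raddf_sum.
rewrite -subr_ge0 -raddfB /=.
have -> : D *m D ^t* - D *m Q *m D ^t* = (D *m (1%:M - Q)) *m (D *m (1%:M - Q)) ^t*.
  have N : (1%:M - Q) ^t* = 1%:M - Q.
    by apply/matrixP => i j; rewrite -{2}Qh !mxE rmorphB rmorph_nat eq_sym.
  rewrite adj_mulmx N !mulmxA -(mulmxA D (1%:M - Q)).
  rewrite mulmxBr mulmx1 mulmxBl mul1mx QQ subrr subr0.
  by rewrite mulmxBr mulmx1 mulmxBl.
exact: trace_gram_ge0.
Qed.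

(** Eigenvalues are roots of the characteristic polynomial, so the probability is a sum over a
    finite list. *)
Lemma measure_pr_seq (sigma : 'M[R[i]]_n) (E : set R[i]) :
  exists l : seq R[i], [/\ uniq l, {in l, forall x, eigenvalue B x},
    {in l, forall x, E x} & measure_pr B sigma E = \sum_(x <- l) \tr (P x *m sigma)].
Proof.
have fin : finite_set ([set x | eigenvalue B x] `&` E).
  have [rs rsE] := closed_field_poly_normal (char_poly B).
  apply: (sub_finite_set _ (finite_seq rs)) => x [/= + _].
  rewrite eigenvalue_root_char rsE rootZ ?lead_coef_eq0 ?monic_neq0 ?char_poly_monic//.
  by rewrite root_prod_XsubC.
pose A := fset_set ([set x | eigenvalue B x] `&` E).
have mA x : x \in (A : seq R[i]) -> eigenvalue B x /\ E x.
  by move=> xA; have : x \in A by []; rewrite in_fset_set// => /set_mem[].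
exists A; split.
- exact: fset_uniq.
- by move=> x /mA[].
- by move=> x /mA[].
- by rewrite /measure_pr fsbig_finite.
Qed.

(** Markov's inequality for the even moment. With [D = M (B - c) ^ m], the outcome [x] contributes
    [|x - c| ^ 2m] times its probability to the trace of [D D ^t*], which is the [2m]-th moment. *)
Lemma markov_measure_pr (M : 'M[R[i]]_n) (c : R[i]) (delta : R) m :
  c^*%C = c -> 0 <= delta ->
  (delta ^+ m.*2)%:C * measure_pr B (M ^t* *m M) [set x | delta%:C <= `|x - c|] <=
  `|\tr ((B - c%:M) ^+ m.*2 *m (M ^t* *m M))|.
Proof.
move=> cr d0.
have [l [ul ev lE ->]] := measure_pr_seq (M ^t* *m M) [set x | delta%:C <= `|x - c|].
pose C := (B - c%:M) ^+ m.
have Ch : C ^t* = C.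
  have Bh : (B - c%:M) ^t* = B - c%:M.
    apply/matrixP => i j; rewrite -{2}hermsymmx_adj !mxE rmorphB rmorphMn /=.
    congr (_ - _ *+ _).
      exact: cr.
    by rewrite eq_sym.
  suff H k : ((B - c%:M) ^+ k) ^t* = (B - c%:M) ^+ k by exact: H.
  elim: k => [|k IH]; first by rewrite !expr0 trmx1 map_mx1.
  rewrite [in LHS]exprS [X in X ^t*]/((B - c%:M) *m (B - c%:M) ^+ k).
  by rewrite adj_mulmx Bh IH [RHS]exprSr.
have PC x : P x *m C = (x - c) ^+ m *: P x.
  suff H k : P x *m (B - c%:M) ^+ k = (x - c) ^+ k *: P x by exact: H.
  elim: k => [|k IH]; first by rewrite !expr0 mulmx1 scale1r.
  rewrite exprSr -[_ ^+ k * _]/(_ ^+ k *m _) mulmxA IH -scalemxAl mulmxBr eigenproj_mull.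
  by rewrite mul_mx_scalar -scalerBl scalerA exprSr.
have CP x : C *m P x = ((x - c) ^+ m)^*%C *: P x.
  by rewrite -[LHS]trmxCK adj_mulmx eigenproj_herm Ch PC adjmxZ eigenproj_herm.
pose D := M *m C.
have -> : \tr ((B - c%:M) ^+ m.*2 *m (M ^t* *m M)) = \tr (D *m D ^t*).
  rewrite -addnn exprD -/C -[C * C]/(C *m C) /D adj_mulmx Ch.
  by rewrite mulmxA mxtrace_mulC !mulmxA.
rewrite (ger0_norm (trace_gram_ge0 D)).
apply: le_trans (trace_eigenproj_le D ul ev).
rewrite mulr_sumr big_seq [leRHS]big_seq; apply: ler_sum => x xl.
have -> : \tr (D *m P x *m D ^t*) = `|x - c| ^+ m.*2 * \tr (P x *m (M ^t* *m M)).
  have -> : D *m P x *m D ^t* = (M *m (C *m P x)) *m (C *m M ^t*).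
    by rewrite /D adj_mulmx Ch !mulmxA.
  rewrite CP -scalemxAr -scalemxAl mulmxA -(mulmxA M) PC -scalemxAr -scalemxAl scalerA.
  rewrite mxtraceZ -mulmxA mxtrace_mulC -mulmxA; congr (_ * _).
  by rewrite -addnn exprD -normrX -expr2 normCK mulrC.
rewrite ler_wpM2r//.
  rewrite mulmxA mxtrace_mulC mulmxA -eigenproj_idem mulmxA -{2}eigenproj_herm.
  by rewrite -mulmxA -adj_mulmx trace_gram_ge0.
rewrite rmorphXn /=; apply: lerXn2r; rewrite ?nnegrE ?ler0c ?normc_ge0//.
exact: lE.
Qed.

End Markov.

(** * Moments of the evolved observable and the tail bound *)

Section Tail.
Variable R : realType.

Lemma sum_succ_exp_le (x : R) N : 0 <= x -> x <= 4^-1 ->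
  \sum_(0 <= k < N) k.+1%:R * x ^+ k <= 2.
Proof.
move=> x0 x4.
(* The remainder makes the induction work: [(N + 1) x ^ N <= 2 ^ N / 4 ^ N = 2 ^ -N]. *)
suff : \sum_(0 <= k < N) k.+1%:R * x ^+ k <= 2 - 2^-1 ^+ N * 2.
  by move=> /le_trans; apply; rewrite lerBlDr lerDl mulr_ge0 ?exprn_ge0.
elim: N => [|N IH]; first by rewrite big_geq// expr0 mul1r subrr.
rewrite big_nat_recr//= (le_trans (lerD IH (_ : _ <= 2^-1 ^+ N)))//.
  have k2 : N.+1%:R <= 2 ^+ N :> R by rewrite -natrX ler_nat ltn_expl.
  apply: le_trans (ler_pM _ _ k2 (_ : _ <= 4^-1 ^+ N)) _ => //.
  - by rewrite exprn_ge0.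
  - by apply: lerXn2r; rewrite ?nnegrE.
  by rewrite -exprMn; apply: lerXn2r; rewrite ?nnegrE; lra.
by rewrite exprS; set y := _ ^+ N; lra.
Qed.

(* (m G) ^ m is nearly minimal at m = 1 / (e G). *)
Lemma optimal_exponent (G T : R) : 0 < G -> 0 <= T -> T * (4 * expR 1 * G) <= 1 ->
  exists m : nat, (m%:R * G) ^+ m <= 2 * expR (- T).
Proof.
(* For [T <= 1/2] the right side is at least 1, so [m = 0] will do. *)
move=> G0 T0 TG; have [T2|T2] := leP T 2^-1.
  exists 0%N; rewrite expr0 (le_trans (_ : 1 <= 2 * (1 - T)))//; first lra.
  by rewrite ler_wpM2l// expR_ge1Dx.
have e0 : 0 < expR 1 :> R := expR_gt0 1.
pose L := (expR 1 * G)^-1.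
have L0 : 0 < L by rewrite invr_gt0 mulr_gt0.
have LT : 4 * T <= L.
  by rewrite /L -[leRHS]mul1r ler_pdivlMr ?mulr_gt0//; move: TG; rewrite mulrA; lra.
(* With [m <= L = 1 / (e G)] the left side is at most [exp (- m)], and [m > L - 1 >= 4 T - 1 > T]
   because [T > 1/2]. *)
exists (Num.truncn L); set m := Num.truncn L.
have /andP[mL Lm] : m%:R <= L < m.+1%:R by apply: truncn_itv; exact: ltW.
have mG : m%:R * G <= expR (-1).
  rewrite expRN -ler_pdivlMr// (le_trans mL)// /L invfM.
  by rewrite mulrC.
apply: (@le_trans _ _ (expR (-1) ^+ m)).
  by apply: lerXn2r; rewrite ?nnegrE ?expR_ge0// mulr_ge0// ltW.
rewrite -expRM_natl mulrN1 (@le_trans _ _ (expR (- T)))//.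
  by rewrite ler_expR lerN2; move: Lm; rewrite -natr1; lra.
by rewrite ler_peMl ?expR_ge0//; lra.
Qed.

End Tail.

(** * Even moments of the observable in the Heisenberg picture *)

Section EvolvedMoments.
Variables (R : realType) (d : nat) (V : finType) (S : {set {set V}}).
Variables g1 g2 : {set V} -> operator R V d.
Hypothesis g1_local : forall X, X \in S -> local X (g1 X).
Hypothesis g2_local : forall X, X \in S -> local X (g2 X).
Hypothesis g1_bound : forall X, X \in S -> opbound 1 (g1 X).
Hypothesis g2_bound : forall X, X \in S -> opbound 1 (g2 X).
Variables (rho : operator R V d) (t : R).
Hypothesis hrho : product_state rho.
Local Notation T := {set {set V}}.
Local Notation D := (max_degree S).
Local Notation G1 := (\sum_(X in S) g1 X).
Local Notation G2 := (\sum_(X in S) g2 X).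
Hypothesis t_small : 2 * D.+1%:R * expR 1 * `|t| <= 4^-1.
Implicit Types (N : nat) (Z : T).

(** The product of the centring factor 2, one factor e from [exp (k + 1) = e * e ^ k], and the bound
    2 of [sum_succ_exp_le]. *)
Let kappa : R := 4 * expR 1.

(* The factor 2 accounts for centering. *)
Definition evolved_weight N (Z : T) : R :=
  2 * \sum_(0 <= k < N) `|t| ^+ k / k`!%:R * cluster_weight R S k Z.

Definition evolved_op N (Z : T) : operator R V d :=
  \sum_(0 <= k < N) (('i%C * t%:C) ^+ k / k`!%:R) *: cluster_op S g1 g2 k Z.

Definition centered (A : operator R V d) : operator R V d := A - (\tr (rho *m A))%:M.

Lemma evolved_weight_ge0 N Z : 0 <= evolved_weight N Z.
Proof.
rewrite mulr_ge0 ?sumr_ge0// => k _.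
by rewrite mulr_ge0 ?cluster_weight_ge0// divr_ge0 ?exprn_ge0.
Qed.

Lemma evolved_weight_supp N Z : ~~ ((Z \subset S) && (Z != finset.set0)) ->
  evolved_weight N Z = 0.
Proof.
move=> ZS; rewrite /evolved_weight big1 ?mulr0// => k _.
have [->|/cluster_weight_supp[h1 h2 _]] := eqVneq (cluster_weight R S k Z) 0.
  by rewrite mulr0.
by move: ZS; rewrite h1 h2.
Qed.

(** The growth [(k + 1)!] of the cluster weights against [1 / k!] leaves [k + 1], and
    [#|Z| <= k + 1] turns the exponential weight into [e ^ (k + 1)]. What remains is the series in
    [x], with [x <= 1/4]. *)
Lemma sum_evolved_weight_expR N Y : Y \in S ->
  \sum_(Z : T | Y \in Z) evolved_weight N Z * expR #|Z|%:R <= kappa.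
Proof.
move=> YS; pose x := 2 * D.+1%:R * expR 1 * `|t|.
have x0 : 0 <= x by rewrite !mulr_ge0 ?expR_ge0.
apply: (@le_trans _ _ (\sum_(0 <= k < N) 2 * (expR 1 * (k.+1%:R * x ^+ k)))); last first.
  rewrite -!mulr_sumr /kappa; have e0 : 0 < expR 1 :> R := expR_gt0 1.
  by have := sum_succ_exp_le N x0 t_small; nra.
under eq_bigr do rewrite /evolved_weight mulr_sumr mulr_suml.
rewrite exchange_big /=; apply: ler_sum => k _.
apply: (@le_trans _ _ (\sum_(Z : T | Y \in Z)
   (2 * (`|t| ^+ k / k`!%:R) * expR k.+1%:R) * cluster_weight R S k Z)).
  apply: ler_sum => Z _.
  have [->|/cluster_weight_supp[_ _ cZ]] := eqVneq (cluster_weight R S k Z) 0.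
    by rewrite !mulr0 mul0r.
  have : expR #|Z|%:R <= expR k.+1%:R :> R by rewrite ler_expR ler_nat.
  have : 0 <= 2 * (`|t| ^+ k / k`!%:R) * cluster_weight R S k Z.
    by rewrite !mulr_ge0 ?invr_ge0 ?exprn_ge0 ?cluster_weight_ge0.
  set p := `|t| ^+ k / _; set q := cluster_weight _ _ _ _ => h1 h2.
  have := ler_wpM2l h1 h2; lra.
have c0 : 0 <= 2 * (`|t| ^+ k / k`!%:R) * expR k.+1%:R :> R.
  by rewrite !mulr_ge0 ?invr_ge0 ?exprn_ge0 ?expR_ge0.
rewrite -mulr_sumr (le_trans (ler_wpM2l c0 (sum_cluster_weight R k YS)))//.
rewrite le_eqVlt; apply/orP; left; apply/eqP.
have -> : expR k.+1%:R = expR 1 ^+ k.+1 :> R by rewrite -expRM_natl mulr1.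
rewrite !exprS factS natrM /x !exprMn.
have k0 : (k`!%:R : R) != 0 by rewrite pnatr_eq0 -lt0n fact_gt0.
by field.
Qed.

Lemma sum_evolved_weight N Y : Y \in S ->
  \sum_(Z : T | Y \in Z) evolved_weight N Z <= kappa.
Proof.
move=> YS; apply: le_trans (sum_evolved_weight_expR N YS); apply: ler_sum => Z _.
by rewrite ler_peMr ?evolved_weight_ge0// -expR0 ler_expR.
Qed.

Lemma sum_evolved_weight_all N :
  \sum_(Z : T) evolved_weight N Z * expR #|Z|%:R <= kappa * #|S|%:R.
Proof.
have w0 Z : 0 <= evolved_weight N Z * expR #|Z|%:R :> R.
  by rewrite mulr_ge0 ?evolved_weight_ge0 ?expR_ge0.
apply: (@le_trans _ _ (\sum_(Y in S) \sum_(Z : T | Y \in Z)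
          evolved_weight N Z * expR #|Z|%:R)).
  rewrite (exchange_big_dep predT)//=; apply: ler_sum => Z _.
  have [/andP[ZS /finset.set0Pn[Y YZ]]|h] := boolP ((Z \subset S) && (Z != finset.set0)).
    rewrite (bigD1 Y) ?(fintype.subsetP ZS)//= lerDl sumr_ge0// => *; exact: w0.
  by rewrite evolved_weight_supp// mul0r sumr_ge0.
apply: le_trans (_ : \sum_(Y in S) kappa <= _); last by rewrite sumr_const mulr_natr.
by apply: ler_sum => Y YS; exact: sum_evolved_weight_expR.
Qed.

(** Each member of [Z] accounts for at most [(D + 1) kappa]; linearity in [#|Z|] is what the
    counting of covered words asks for. *)
Lemma sum_evolved_weight_meets N (Z : T) :
  \sum_(Z' | meets (cluster_supp S) Z Z') evolved_weight N Z' <=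
  #|Z|%:R * (D.+1%:R * kappa).
Proof.
have k0 : 0 <= kappa by rewrite mulr_ge0 ?expR_ge0.
have [ZS|ZS] := boolP (Z \subset S); last first.
  rewrite big_pred0 ?mulr_ge0// => Z'.
  by rewrite /meets {1}/cluster_supp (negPf ZS) finset.set0I eqxx.
apply: (@le_trans _ _ (\sum_(Y in Z) \sum_(Z' | Y :&: cluster_supp S Z' != finset.set0)
    evolved_weight N Z')).
  rewrite (exchange_big_dep predT)//= [leLHS]big_mkcond; apply: ler_sum => Z' _.
  case: ifP => [|_]; last by apply: sumr_ge0 => *; exact: evolved_weight_ge0.
  rewrite /meets finset.setIC => /cluster_supp_meets[Y [YZ _ YZ']].
  rewrite (bigD1 Y) /=; last by rewrite YZ.
  by rewrite lerDl; apply: sumr_ge0 => *; exact: evolved_weight_ge0.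
rewrite mulr_natl -sumr_const; apply: ler_sum => Y YZ.
apply: sum_neighbours => //.
- by move=> Z'; exact: evolved_weight_ge0.
- exact: (fintype.subsetP ZS).
- by move=> Y'; exact: sum_evolved_weight.
Qed.

Lemma evolved_op_bound N Z :
  opbound (evolved_weight N Z / 2) (evolved_op N Z).
Proof.
rewrite /evolved_weight mulrC mulKf ?pnatr_eq0//.
apply: opbound_sum => k _.
have -> : `|t| ^+ k / k`!%:R = normc (('i%C * t%:C) ^+ k / k`!%:R) :> R.
  apply/complexI; rewrite -normr_normc normrM normrX normrM.
  rewrite rmorphM rmorphXn /= fmorphV /= rmorph_nat.
  rewrite normfV normr_nat; congr (_ ^+ _ / _).
  by rewrite complexiE normCi mul1r normc_def /= expr0n addr0 sqrtr_sqr.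
by apply: opboundZ; apply: cluster_op_bound.
Qed.

Lemma centered_bound A c : opbound c A -> opbound (c + c) (centered A).
Proof.
move=> hA; apply: opboundD => //; apply: opboundN.
rewrite -scalemx1; apply: opbound_le (opboundZ _ (@opbound1 _ _)).
by rewrite mulr1; exact: trace_state_le.
Qed.

(** Centring is linear, so every cluster operator is centred separately. The counting bound then
    applies with [k1 = kappa |S|] and [k2 = (D + 1) kappa]. *)
Lemma truncated_moment N m :
  normc (\tr (rho *m (centered (\sum_Z evolved_op N Z)) ^+ m.*2)) <=
  (4 * (kappa * #|S|%:R * (D.+1%:R * kappa) * m.*2%:R)) ^+ m.
Proof.
have -> : centered (\sum_Z evolved_op N Z) = \sum_Z centered (evolved_op N Z).
  rewrite sumrB /centered mulmx_sumr (linear_sum (@mxtrace _ _)) /=.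
  by rewrite (raddf_sum (@scalar_mx _ _)).
have [_ tr1 _] := product_state_factor hrho.
apply: le_trans (moment_le (w := evolved_weight N) (supp := cluster_supp S)
  hrho _ _ _ _ _) _.
- move=> Z; apply: localD.
    apply: local_sum => k _; apply: localZ; exact: cluster_op_local.
  by apply: localN; rewrite -scalemx1; apply: localZ; exact: local1.
- move=> Z; rewrite [evolved_weight _ _]splitr.
  by apply: centered_bound; exact: evolved_op_bound.
- by move=> Z; rewrite /centered mulmxBr raddfB /= mul_mx_scalar mxtraceZ tr1 mulr1 subrr.
- by move=> Z; exact: evolved_weight_ge0.
apply: (sum_covered_prod (s := fun Z : T => #|Z|)).
- by move=> Z; exact: evolved_weight_ge0.
- exact: sum_evolved_weight_all.
- exact: sum_evolved_weight_meets.
- by rewrite !mulr_ge0 ?expR_ge0.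
- by move=> Z Z'; rewrite /meets finset.setIC.
- exact: finset.set0.
Qed.

Local Notation gen := (('i%C * t%:C) *: G1).

Lemma sum_evolved_op N : \sum_Z evolved_op N Z =
  \sum_(0 <= m < N) (m`!%:R^-1 : R[i]) *: iter m (fun C => gen *m C - C *m gen) G2.
Proof.
rewrite exchange_big; apply: eq_bigr => k _.
rewrite -scaler_sumr (sum_cluster_op g1_local g2_local).
rewrite mulrC -[LHS]scalerA; congr (_ *: _); move: ('i%C * t%:C) => z.
elim: k => [|k IH]; first by rewrite expr0 scale1r.
rewrite !iterS -IH /commutator exprS -[LHS]scalerA; move: (iter k _ _) (z ^+ k) => C y.
by rewrite -!scalemxAl -!scalemxAr [y *: (z *: _)]scalerA [y * z]mulrC -scalerA !scalerBr.
Qed.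

(** The bound for truncations does not depend on [N], and the truncated moments converge to the
    moment of the evolved operator. *)
Lemma evolved_moment m :
  normc (\tr (rho *m (centered (expm gen *m G2 *m expm (- gen))) ^+ m.*2)) <=
  (4 * (kappa * #|S|%:R * (D.+1%:R * kappa) * m.*2%:R)) ^+ m.
Proof.
set W := expm gen *m _ *m _; pose u N := \sum_Z evolved_op N Z.
have uW : mx_cvg u W.
  have := expm_conj_cvg gen G2; rewrite -/W.
  by congr (mx_cvg _ W); apply/funext => N; rewrite /u sum_evolved_op.
have cW : mx_cvg (fun N => centered (u N)) (centered W).
  pose c := norm1 (1%:M : operator R V d).
  apply: (@mx_cvg_le _ _ _ _ (fun N => norm1 (u N - W) + norm1 rho * norm1 (u N - W) * c)).
    move=> N; have -> : centered (u N) - centered W =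
        (u N - W) - (\tr (rho *m (u N - W))) *: 1%:M.
      rewrite /centered mulmxBr (linearB (@mxtrace _ _)) /= scalerBl !scalemx1 !opprB.
      by rewrite addrACA [RHS]addrACA; congr (_ + _); exact: addrC.
    rewrite (le_trans (norm1D _ _))// lerD// norm1N norm1Z ler_wpM2r ?norm1_ge0//.
    by rewrite (le_trans (norm1_trace _))// norm1M.
  rewrite -[X in _ --> X]addr0; apply: cvgD => //.
  rewrite -[X in _ --> X](mul0r c); apply: cvgM; last exact: cvg_cst.
  by rewrite -[X in _ --> X](mulr0 (norm1 rho)); apply: cvgM => //; exact: cvg_cst.
have pW := mx_cvgX m.*2 cW; set K := (4 * _) ^+ m.
have : (fun N => K + norm1 rho *
    norm1 (centered (u N) ^+ m.*2 - centered W ^+ m.*2)) @ \oo --> K.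
  rewrite -[X in _ --> X]addr0; apply: cvgD; first exact: cvg_cst.
  by rewrite -[X in _ --> X](mulr0 (norm1 rho)); apply: cvgM => //; exact: cvg_cst.
move=> cK; rewrite -(cvg_lim (@Rhausdorff R) cK); apply: limr_ge.
  by apply/cvg_ex; exists K.
apply: nearW => N.
have -> : centered W ^+ m.*2 =
    centered (u N) ^+ m.*2 - (centered (u N) ^+ m.*2 - centered W ^+ m.*2).
  by rewrite opprB addrC subrK.
rewrite mulmxBr raddfB /= (le_trans (ler_normcD _ _))// lerD//.
  exact: truncated_moment.
by rewrite normcN (le_trans (norm1_trace _))// (le_trans (norm1M _ _))// subKr.
Qed.

End EvolvedMoments.

(** * Local Hamiltonians as sums of local terms of norm at most one *)

Section Hamiltonian.
Variables (R : realType) (d : nat) (V : finType) (S : {set {set V}}).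
Variables (lam : {set V} -> R) (h : {set V} -> operator R V d).
Hypothesis hS : local_terms S lam h.

Lemma local_term_local X : X \in S -> local X ((lam X)%:C *: h X).
Proof. by case/hS => _ _ [hX _] _; apply: localZ; exact: acts_within_local. Qed.

Lemma local_term_bound X : X \in S -> opbound 1 ((lam X)%:C *: h X).
Proof.
case/hS => lX _ _ hX; apply: opbound_le (opboundZ _ (opnorm1_opbound hX)).
by rewrite mulr1 normc_real.
Qed.

Lemma hamiltonian_adj : (hamiltonian S lam h) ^t* = hamiltonian S lam h.
Proof.
rewrite /hamiltonian adjmx_sum; apply: eq_bigr => X /hS[_ hX _ _].
by rewrite adjmxZ conjc_real (hermsymmx_adj hX).
Qed.

End Hamiltonian.

(** * Conjugation identities, numerical constants and the conclusion *)

Lemma mxtrace_adj (R : realType) n (A : 'M[R[i]]_n) : \tr (A ^t*) = (\tr A)^*%C.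
Proof. by rewrite /mxtrace rmorph_sum; apply: eq_bigr => i _; rewrite !mxE. Qed.

Lemma expr_conj (K : pzRingType) n (U U' A : 'M[K]_n) m :
  U *m U' = 1%:M -> U' *m U = 1%:M ->
  (U *m A *m U') ^+ m = U *m A ^+ m *m U'.
Proof.
move=> UU' U'U; elim: m => [|m IH]; first by rewrite !expr0 mulmx1.
rewrite !exprSr IH -[LHS]/(U *m A ^+ m *m U' *m (U *m A *m U')).
by rewrite -[A ^+ m * A]/(A ^+ m *m A) !mulmxA -(mulmxA _ U') U'U mulmx1.
Qed.

Lemma trace_conj (K : comPzRingType) n (U U' A r : 'M[K]_n) :
  \tr (A *m (U' *m r *m U)) = \tr (r *m (U *m A *m U')).
Proof. by rewrite mulmxA mxtrace_mulC [RHS]mxtrace_mulC !mulmxA. Qed.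

(** The left side is at most [1 / (7 e D)], hence at most 1/7. *)
Lemma evolution_time_le (R : realType) (e D t : R) : 1 <= e -> 1 <= D ->
  `|t| <= (2 * e ^+ 2 * D * (D + 1))^-1 / 7 -> 2 * (D + 1) * e * `|t| <= 4^-1.
Proof.
move=> e1 D1 ht; have e0 : 0 < e by apply: lt_le_trans e1.
have D0 : 0 < D by apply: lt_le_trans D1.
have D10 : 0 < D + 1 by apply: addr_gt0.
have c0 : 0 <= 2 * (D + 1) * e by rewrite !mulr_ge0 ?ltW.
apply: (le_trans (ler_wpM2l c0 ht)).
have -> : 2 * (D + 1) * e * ((2 * e ^+ 2 * D * (D + 1))^-1 / 7) = (7 * (e * D))^-1.
  by field; rewrite !gt_eqF.
rewrite lef_pV2 ?posrE ?mulr_gt0//.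
have : 1 <= e * D by apply: mulr_ege1.
lra.
Qed.

(** The condition of [optimal_exponent] for the moment bound at hand. The left side equals
    [128 / (c ^ 2 e D ^ 2 (D + 1))], and [12 ^ 2 = 144] exceeds 128. *)
Lemma tail_exponent_le (R : realType) (e D s delta c : R) :
  1 <= e -> 1 <= D -> 0 < s -> 0 < delta -> 12 <= c ->
  (delta * (2 * e ^+ 2 * D * (D + 1))^-1) ^+ 2 / (c ^+ 2 * s) *
  (4 * e * (2 * (4 * (4 * e * s * ((D + 1) * (4 * e)))) / delta ^+ 2)) <= 1.
Proof.
move=> e1 D1 s0 d0 c12; have e0 : 0 < e by apply: lt_le_trans e1.
have D0 : 0 < D by apply: lt_le_trans D1.
have D10 : 0 < D + 1 by apply: addr_gt0.
have c0 : 0 < c by apply: lt_le_trans c12.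
set L := (X in X <= _); have -> : L = 128 / (c ^+ 2 * (e * D ^+ 2 * (D + 1))).
  by rewrite /L; field; rewrite !gt_eqF.
have h : 1 <= e * D ^+ 2 * (D + 1).
  by rewrite !mulr_ege1 ?exprn_ege1//; lra.
have c2 : 128 <= c ^+ 2 by nra.
rewrite ler_pdivrMr ?mulr_gt0 ?exprn_gt0// mul1r; apply: le_trans c2 _.
by rewrite ler_peMr// exprn_ge0// ltW.
Qed.

(** Dividing the moment bound by [delta ^ 2m] gives [p <= (m G) ^ m] with [G = 2 B / delta ^ 2]; the
    order [m] is then chosen by [optimal_exponent]. *)
Lemma tail_bound (R : realType) (D s delta c : R) (p : R[i]) :
  1 <= D -> 0 < s -> 0 < delta -> 12 <= c ->
  (forall m, (delta ^+ m.*2)%:C * p <=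
     ((4 * (4 * expR 1 * s * ((D + 1) * (4 * expR 1)) * m.*2%:R)) ^+ m)%:C) ->
  p <= (2 * expR (- ((delta * (2 * expR 1 ^+ 2 * D * (D + 1))^-1) ^+ 2
                     / (c ^+ 2 * s))))%:C.
Proof.
move=> D1 s0 d0 c12; have e1 : 1 <= expR 1 :> R by rewrite -[leLHS]expR0 ler_expR.
have := @optimal_exponent R; move: (expR 1) e1 => e e1 opt key.
have e0 : 0 < e by apply: lt_le_trans e1.
have D10 : 0 < D + 1 by apply: addr_gt0 => //; apply: lt_le_trans D1.
pose B := 4 * (4 * e * s * ((D + 1) * (4 * e))).
have B0 : 0 < B by rewrite !mulr_gt0.
have G0 : 0 < 2 * B / delta ^+ 2 by rewrite divr_gt0 ?mulr_gt0 ?exprn_gt0.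
have T0 : 0 <= (delta * (2 * e ^+ 2 * D * (D + 1))^-1) ^+ 2 / (c ^+ 2 * s).
  by apply: divr_ge0; [exact: sqr_ge0 | apply: mulr_ge0; [exact: sqr_ge0 | exact: ltW]].
have [m mG] := opt _ _ G0 T0 (tail_exponent_le e1 D1 s0 d0 c12).
apply: (@le_trans _ _ ((m%:R * (2 * B / delta ^+ 2)) ^+ m)%:C); last by rewrite lecR.
have dm : 0 < (delta ^+ m.*2)%:C :> R[i] by rewrite ltcR exprn_gt0.
rewrite -(ler_pM2l dm) (le_trans (key m))// -rmorphM lecR /=.
rewrite le_eqVlt; apply/orP; left; apply/eqP.
rewrite -mul2n exprM -exprMn natrM; congr (_ ^+ _).
by rewrite /B; field; rewrite gt_eqF.
Qed.

Theorem corollary14 (R : realType) (V : finType) (d k : nat)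
    (S : {set {set V}})
    (lam1 lam2 : {set V} -> R) (h1 h2 : {set V} -> operator R V d)
    (rho : operator R V d) (t delta : R)
    (hk : forall X : {set V}, X \in S -> (#|X| <= k)%N)
    (hH1 : local_terms S lam1 h1)
    (hH2 : local_terms S lam2 h2)
    (hdeg : (1 <= max_degree S)%N)
    (hrho : product_state rho)
    (ht : `|t| <= tL R (max_degree S) / 7)
    (hdelta : 0 < delta) :
  let H1 := hamiltonian S lam1 h1 in
  let H2 := hamiltonian S lam2 h2 in
  let rho_t := evolve H1 t rho in
  measure_pr H2 rho_t [set x : R[i] | delta%:C <= `|x - \tr (rho_t *m H2)|]
  <= (2 * expR (- ((delta * tL R (max_degree S)) ^+ 2
                   / (250 ^+ 2 * #|S|%:R))))%:C.
Proof.
cbv zeta; set H1 := hamiltonian S lam1 h1; set H2 := hamiltonian S lam2 h2.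
set rho_t := evolve H1 t rho; have H1h : H1 ^t* = H1 := hamiltonian_adj hH1.
have H2h : H2 ^t* = H2 := hamiltonian_adj hH2.
pose A := ('i%C * t%:C) *: H1.
have Ah : A ^t* = - A.
  rewrite adjmxZ H1h -scaleNr; congr (_ *: _).
  by apply/eqP; rewrite eq_complex /=; apply/andP; split; apply/eqP; ring.
have [[M rhoE] _ _] := product_state_factor hrho.
have rho_tE : rho_t = expm (- A) *m rho *m expm A by rewrite /rho_t /evolve scaleNr.
(* [expm A] is unitary as [A] is anti-Hermitian, and the evolved state keeps the Gram form required
   by Markov's inequality. *)
have rho_tM : rho_t = (M *m expm A) ^t* *m (M *m expm A).
  by rewrite rho_tE rhoE adj_mulmx expm_adj Ah !mulmxA.
have rho_th : rho_t ^t* = rho_t.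
  by rewrite rho_tM; move: (M *m expm A) => N; rewrite adj_mulmx trmxCK.
set c := \tr (rho_t *m H2).
have cr : c^*%C = c by rewrite -mxtrace_adj adj_mulmx H2h rho_th mxtrace_mulC.
have NA : expm (- A) *m expm A = 1%:M by rewrite -{2}(opprK A) expmN_mul.
pose W := expm A *m H2 *m expm (- A).
have cW : \tr (rho *m W) = c.
  by rewrite /c [RHS]mxtrace_mulC rho_tE [RHS]trace_conj.
(* Conjugation respects powers and fixes scalars, so the central moments of [H2] in [rho_t] are
   those of its Heisenberg evolution [W] in the product state [rho]. *)
have powW m : centered rho W ^+ m = expm A *m (H2 - c%:M) ^+ m *m expm (- A).
  rewrite -(expr_conj _ _ (expmN_mul A) NA) /centered cW mulmxBr mulmxBl.
  by rewrite -scalemx1 -scalemxAr mulmx1 -scalemxAl expmN_mul.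
have e1 : 1 <= expR 1 :> R by rewrite -[leLHS]expR0 ler_expR.
have D1 : 1 <= (max_degree S)%:R :> R by rewrite ler1n.
have t_small : 2 * (max_degree S).+1%:R * expR 1 * `|t| <= 4^-1.
  by rewrite -[(max_degree S).+1%:R]natr1; exact: evolution_time_le.
(* A graph of positive maximum degree has a vertex. *)
have S0 : 0 < #|S|%:R :> R.
  rewrite ltr0n card_gt0; apply: contraTneq hdeg => S0.
  by rewrite /max_degree S0 big_set0.
have c12 : 12 <= 250 :> R by rewrite ler_nat.
rewrite /tL; apply: (tail_bound D1 S0 hdelta c12) => m.
have H2s : H2 \is hermsymmx by rewrite hermsymmxE H2h.
rewrite rho_tM; apply: le_trans (markov_measure_pr H2s _ _ cr (ltW hdelta)) _.
rewrite -rho_tM normr_normc lecR.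
have -> : \tr ((H2 - c%:M) ^+ m.*2 *m rho_t) = \tr (rho *m centered rho W ^+ m.*2).
  by rewrite rho_tE trace_conj -powW.
rewrite natr1.
exact: (evolved_moment (local_term_local hH1) (local_term_local hH2)
          (local_term_bound hH1) (local_term_bound hH2) hrho t_small m).
Qed.
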